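(* Let $\mathcal C$ be the path category of a thread quiver $(Q,\mathcal P)$. The category $\mathrm{rep}^{\mathrm{qnf}}(\mathcal C)$ of quasi noise free representations is a Serre subcategory of $\mathrm{rep}^{\mathrm{pwf}}(\mathcal C)$. In particular, it is abelian.
   Context: $k$ is an algebraically closed field. A thread quiver $(Q,\mathcal P)$ consists of a (possibly infinite) quiver $Q=(Q_0,Q_1,s,t)$ and, for every arrow $\alpha$, a (possibly empty) linearly ordered set $\mathcal P_\alpha$; $\overline{\mathcal P}_\alpha=\mathcal P_\alpha\sqcup\{\min(\alpha),\max(\alpha)\}$ is obtained by adding a new least element $\min(\alpha)$ and a new greatest element $\max(\alpha)$. Its path category $\mathcal C$ is the $k$-linear category with object set $Q_0\sqcup\bigsqcup_\alpha\mathcal P_\alpha$, where $\min(\alpha),\max(\alpha)$ are viewed as the objects $s(\alpha),t(\alpha)$ (they remain distinct elements of $\overline{\mathcal P}_\alpha$ even if $\alpha$ is a loop). For $x\le y$ in $\overline{\mathcal P}_\alpha$ there is a morphism $\eta_{y,x}=\eta_{yx}:x\to y$, with $\eta_{xx}=e_x$ the identity, $\eta_{zy}\eta_{yx}=\eta_{zx}$ for $x\le y\le z$, and $\eta_{\max(\alpha),\min(\alpha)}=\alpha$; write $\eta_{t(\alpha),x}:=\eta_{\max(\alpha),x}$ and $\eta_{x,s(\alpha)}:=\eta_{x,\min(\alpha)}$. The space $\mathrm{Hom}_{\mathcal C}(x,y)$ has as $k$-basis the distinct path-like elements from $x$ to $y$: the identities $e_x$, the $\eta_{yx}$, and the elements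 $\eta_{y,s(\beta)}\,p\,\eta_{t(\alpha),x}$ with $x\in\overline{\mathcal P}_\alpha$, $y\in\overline{\mathcal P}_\beta$ and $p$ a (possibly trivial) path of $Q$ from $t(\alpha)$ to $s(\beta)$. Composition is induced by concatenation of paths in $Q$ together with the relations $\eta_{zy}\eta_{yx}=\eta_{zx}$ for $x\le y\le z$ in $\overline{\mathcal P}_\alpha$ and $\eta_{\max(\alpha),\min(\alpha)}=\alpha$, for every arrow $\alpha$. $\mathrm{rep}^{\mathrm{pwf}}(\mathcal C)$ is the category of covariant $k$-linear functors from $\mathcal C$ to finite-dimensional $k$-vector spaces. $M$ is noise if $M(x)=0$ for all $x\in Q_0$, and noise free if no nonzero direct summand of $M$ is noise. Every $M\in\mathrm{rep}^{\mathrm{pwf}}(\mathcal C)$ has a decomposition, unique up to isomorphism of summands, $M=M_{NF}\oplus\bigoplus_{\alpha\in Q_1}U_\alpha$ with $M_{NF}$ noise free and $\mathrm{supp}(U_\alpha)\subseteq\mathcal P_\alpha$; $M$ is quasi noise free if each $U_\alpha$ is a finite direct sum of indecomposables. $\mathrm{rep}^{\mathrm{qnf}}(\mathcal C)$ is the full subcategory of $\mathrm{rep}^{\mathrm{pwf}}(\mathcal C)$ of quasi noise free representations. *)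

(* Defs.v *)
From HB Require Import structures.
From mathcomp Require Import all_boot all_order all_algebra.
From mathcomp Require Import finmap.
From mathcomp Require Import boolp.
From mathcomp.multinomials Require Import monalg.

Set Implicit Arguments.
Unset Strict Implicit.
Unset Printing Implicit Defensive.

Import GRing.Theory.
Local Open Scope ring_scope.

(** * k-linear categories *)

(* The type of objects is a parameter and not a field: the small category of
   a thread quiver and the large category of its representations then live at
   different universe levels. *)
Record lincat (k : fieldType) (T : Type) := Lincat {
  hom : T -> T -> lmodType k;
  idm : forall x, hom x x;
  comp : forall x y z, hom y z -> hom x y -> hom x z;
  lc_comp1m : forall x y (f : hom x y), comp (idm y) f = f;
  lc_compm1 : forall x y (f : hom x y), comp f (idm x) = f;
  lc_compA : forall w x y z (h : hom y z) (g : hom x y) (f : hom w x),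
    comp h (comp g f) = comp (comp h g) f;
  lc_compPl : forall x y z a (g g' : hom y z) (f : hom x y),
    comp (a *: g + g') f = a *: comp g f + comp g' f;
  lc_compPr : forall x y z a (g : hom y z) (f f' : hom x y),
    comp g (a *: f + f') = a *: comp g f + comp g f' }.
Arguments hom {k T} C x y : rename.
Arguments idm {k T} C x : rename.
Arguments comp {k T} C {x y z} g f : rename.

Section CategoryNotions.
Variables (k : fieldType) (T : Type) (C : lincat k T).
Implicit Types X Y Z W : T.

Definition mono X Y (f : hom C X Y) : Prop :=
  forall W (g h : hom C W X), comp C f g = comp C f h -> g = h.

Definition epi X Y (f : hom C X Y) : Prop :=
  forall W (g h : hom C Y W), comp C g f = comp C h f -> g = h.

(* [i] is a kernel of [f] *)
Definition is_kernel X Y K (f : hom C X Y) (i : hom C K X) : Prop :=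
  comp C f i = 0 /\
  forall W (h : hom C W X), comp C f h = 0 ->
    exists! u : hom C W K, comp C i u = h.

(* [q] is a cokernel of [f] *)
Definition is_cokernel X Y Q (f : hom C X Y) (q : hom C Y Q) : Prop :=
  comp C q f = 0 /\
  forall W (h : hom C Y W), comp C h f = 0 ->
    exists! u : hom C Q W, comp C u q = h.

Definition is_zero X : Prop :=
  forall Y, (forall f : hom C X Y, f = 0) /\ (forall f : hom C Y X, f = 0).

Definition is_biproduct X Y S (i1 : hom C X S) (i2 : hom C Y S)
    (p1 : hom C S X) (p2 : hom C S Y) : Prop :=
  [/\ comp C p1 i1 = idm C X, comp C p2 i2 = idm C Y,
      comp C p2 i1 = 0, comp C p1 i2 = 0
    & comp C i1 p1 + comp C i2 p2 = idm C S].

Definition direct_sum X Y S : Prop :=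
  exists i1 i2 p1 p2, @is_biproduct X Y S i1 i2 p1 p2.

Definition is_coproduct (I : Type) (X : I -> T) S
    (inj : forall i, hom C (X i) S) : Prop :=
  forall W (h : forall i, hom C (X i) W),
    exists! u : hom C S W, forall i, comp C u (inj i) = h i.

Definition direct_sum_fam (I : Type) (X : I -> T) S : Prop :=
  exists inj, @is_coproduct I X S inj.

Definition direct_summand X Y : Prop := exists X', direct_sum X X' Y.

Definition indecomposable X : Prop :=
  ~ is_zero X /\ forall Y Z, direct_sum Y Z X -> is_zero Y \/ is_zero Z.

Record is_abelian : Prop := IsAbelian {
  ab_zero : exists X, is_zero X;
  ab_biproduct : forall X Y, exists S, direct_sum X Y S;
  ab_kernel : forall X Y (f : hom C X Y),
    exists K (i : hom C K X), is_kernel f i;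
  ab_cokernel : forall X Y (f : hom C X Y),
    exists Q (q : hom C Y Q), is_cokernel f q;
  ab_mono : forall X Y (f : hom C X Y), mono f ->
    exists Z (g : hom C Y Z), is_kernel g f;
  ab_epi : forall X Y (f : hom C X Y), epi f ->
    exists Z (g : hom C Z X), is_cokernel g f }.

Definition short_exact X Y Z (f : hom C X Y) (g : hom C Y Z) : Prop :=
  is_kernel g f /\ is_cokernel f g.

Definition is_serre (S : T -> Prop) : Prop :=
  (exists X, S X) /\
  forall X Y Z (f : hom C X Y) (g : hom C Y Z),
    short_exact f g -> (S Y <-> S X /\ S Z).

Definition full_subcat (S : T -> Prop) : lincat k {A : T | S A} :=
  @Lincat k {A : T | S A}
    (fun A B => hom C (sval A) (sval B))
    (fun A => idm C (sval A))
    (fun A B B' g f => comp C g f)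
    (fun A B => @lc_comp1m k T C (sval A) (sval B))
    (fun A B => @lc_compm1 k T C (sval A) (sval B))
    (fun A A' B B' => @lc_compA k T C (sval A) (sval A') (sval B) (sval B'))
    (fun A B B' => @lc_compPl k T C (sval A) (sval B) (sval B'))
    (fun A B B' => @lc_compPr k T C (sval A) (sval B) (sval B')).

End CategoryNotions.

Lemma fdvect_compPl (k : fieldType) (U V W : vectType k) (a : k)
    (g g' : 'Hom(V, W)) (f : 'Hom(U, V)) :
  ((a *: g + g') \o f = a *: (g \o f) + (g' \o f))%VF.
Proof. by rewrite comp_lfunDl comp_lfunZl. Qed.

Lemma fdvect_compPr (k : fieldType) (U V W : vectType k) (a : k)
    (g : 'Hom(V, W)) (f f' : 'Hom(U, V)) :
  (g \o (a *: f + f') = a *: (g \o f) + (g \o f'))%VF.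
Proof. by rewrite comp_lfunDr comp_lfunZr. Qed.

Definition fdvect (k : fieldType) : lincat k (vectType k) :=
  @Lincat k (vectType k)
    (fun V W => 'Hom(V, W))
    (fun V => \1%VF)
    (fun U V W g f => (g \o f)%VF)
    (fun V W f => comp_lfun1l f)
    (fun V W f => comp_lfun1r f)
    (fun U V W Z h g f => comp_lfunA h g f)
    (@fdvect_compPl k)
    (@fdvect_compPr k).

(** * Categories of k-linear functors *)

Record linfunctor (k : fieldType) (T U : Type)
    (C : lincat k T) (D : lincat k U) := Linfunctor {
  fobj :> T -> U;
  fmor : forall x y, hom C x y -> hom D (fobj x) (fobj y);
  lf_linear : forall x y a (f g : hom C x y),
    fmor (a *: f + g) = a *: fmor f + fmor g;
  lf_id : forall x, fmor (idm C x) = idm D (fobj x);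
  lf_comp : forall x y z (g : hom C y z) (f : hom C x y),
    fmor (comp C g f) = comp D (fmor g) (fmor f) }.
Arguments fmor {k T U C D} F {x y} f : rename.

Section NaturalTransformations.
Variables (k : fieldType) (T U : Type) (C : lincat k T) (D : lincat k U).

Record nattrans (F G : linfunctor C D) := Nattrans {
  ncomp :> forall x, hom D (F x) (G x);
  nt_natural : forall x y (f : hom C x y),
    comp D (ncomp y) (fmor F f) = comp D (fmor G f) (ncomp x) }.

Lemma nattransP F G (u v : nattrans F G) : (forall x, u x = v x) -> u = v.
Proof.
case: u v => [u hu] [v hv] /= E.
have {E} E : u = v by apply: functional_extensionality_dep.
by subst v; congr Nattrans; apply: Prop_irrelevance.
Qed.

Lemma lc_comp0l x y z (f : hom D x y) : comp D (0 : hom D y z) f = 0.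
Proof.
have := lc_compPl (-1) (0 : hom D y z) 0 f.
by rewrite scaler0 addr0 scaleN1r addNr.
Qed.

Lemma lc_comp0r x y z (g : hom D y z) : comp D g (0 : hom D x y) = 0.
Proof.
have := lc_compPr (-1) g (0 : hom D x y) 0.
by rewrite scaler0 addr0 scaleN1r addNr.
Qed.

Lemma lc_compDl x y z (g g' : hom D y z) (f : hom D x y) :
  comp D (g + g') f = comp D g f + comp D g' f.
Proof. by have := lc_compPl 1 g g' f; rewrite !scale1r. Qed.

Lemma lc_compDr x y z (g : hom D y z) (f f' : hom D x y) :
  comp D g (f + f') = comp D g f + comp D g f'.
Proof. by have := lc_compPr 1 g f f'; rewrite !scale1r. Qed.

Lemma lc_compZl x y z a (g : hom D y z) (f : hom D x y) :
  comp D (a *: g) f = a *: comp D g f.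
Proof. by have := lc_compPl a g 0 f; rewrite lc_comp0l !addr0. Qed.

Lemma lc_compZr x y z a (g : hom D y z) (f : hom D x y) :
  comp D g (a *: f) = a *: comp D g f.
Proof. by have := lc_compPr a g f 0; rewrite lc_comp0r !addr0. Qed.

Section Operations.
Variables F G : linfunctor C D.
Implicit Types u v w : nattrans F G.

Program Definition nt_zero : nattrans F G := @Nattrans F G (fun x => 0) _.
Next Obligation. by rewrite lc_comp0l lc_comp0r. Qed.

Program Definition nt_opp u : nattrans F G := @Nattrans F G (fun x => - u x) _.
Next Obligation. by rewrite -!scaleN1r lc_compZl lc_compZr nt_natural. Qed.

Program Definition nt_add u v : nattrans F G :=
  @Nattrans F G (fun x => u x + v x) _.
Next Obligation. by rewrite lc_compDl lc_compDr !nt_natural. Qed.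

Program Definition nt_scale (a : k) u : nattrans F G :=
  @Nattrans F G (fun x => a *: u x) _.
Next Obligation. by rewrite lc_compZl lc_compZr nt_natural. Qed.

Lemma nt_addA : associative nt_add.
Proof. by move=> u v w; apply: nattransP => x /=; rewrite addrA. Qed.
Lemma nt_addC : commutative nt_add.
Proof. by move=> u v; apply: nattransP => x /=; rewrite addrC. Qed.
Lemma nt_add0 : left_id nt_zero nt_add.
Proof. by move=> u; apply: nattransP => x /=; rewrite add0r. Qed.
Lemma nt_addN : left_inverse nt_zero nt_opp nt_add.
Proof. by move=> u; apply: nattransP => x /=; rewrite addNr. Qed.

HB.instance Definition _ := gen_eqMixin (nattrans F G).
HB.instance Definition _ := gen_choiceMixin (nattrans F G).
HB.instance Definition _ :=
  GRing.isZmodule.Build (nattrans F G) nt_addA nt_addC nt_add0 nt_addN.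

Lemma nt_scaleA (a b : k) u :
  nt_scale a (nt_scale b u) = nt_scale (a * b) u.
Proof. by apply: nattransP => x /=; rewrite scalerA. Qed.
Lemma nt_scale1 : left_id 1 nt_scale.
Proof. by move=> u; apply: nattransP => x /=; rewrite scale1r. Qed.
Lemma nt_scaleDr : right_distributive nt_scale +%R.
Proof. by move=> a u v; apply: nattransP => x /=; rewrite scalerDr. Qed.
Lemma nt_scaleDl u : {morph nt_scale^~ u : a b / a + b}.
Proof. by move=> a b; apply: nattransP => x /=; rewrite scalerDl. Qed.

HB.instance Definition _ :=
  GRing.Zmodule_isLmodule.Build k (nattrans F G)
    nt_scaleA nt_scale1 nt_scaleDr nt_scaleDl.

End Operations.

Program Definition nt_id (F : linfunctor C D) : nattrans F F :=
  @Nattrans F F (fun x => idm D (F x)) _.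
Next Obligation. by rewrite lc_comp1m lc_compm1. Qed.

Program Definition nt_comp (F G H : linfunctor C D)
    (v : nattrans G H) (u : nattrans F G) : nattrans F H :=
  @Nattrans F H (fun x => comp D (v x) (u x)) _.
Next Obligation. by rewrite -lc_compA nt_natural !lc_compA nt_natural. Qed.

Program Definition functor_cat : lincat k (linfunctor C D) :=
  @Lincat k (linfunctor C D)
    (fun F G => nattrans F G) nt_id nt_comp _ _ _ _ _.
Next Obligation. by apply: nattransP => z /=; rewrite lc_comp1m. Qed.
Next Obligation. by apply: nattransP => z /=; rewrite lc_compm1. Qed.
Next Obligation. by apply: nattransP => t /=; rewrite lc_compA. Qed.
Next Obligation. by apply: nattransP => t /=; rewrite lc_compPl. Qed.
Next Obligation. by apply: nattransP => t /=; rewrite lc_compPr. Qed.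

End NaturalTransformations.
Arguments functor_cat {k T U} C D.

(** * Thread quivers *)

Record thread_quiver := ThreadQuiver {
  vertex : Type;
  arrow : Type;
  source : arrow -> vertex;
  target : arrow -> vertex;
  thread_disp : arrow -> Order.disp_t;
  thread : forall a : arrow, orderType (thread_disp a) }.

Section PathCategory.
Variable Q : thread_quiver.
Implicit Types (a : arrow Q) (v : vertex Q).

Inductive obj := Vtx of vertex Q | Pt (a : arrow Q) of thread a.

(* paths of [Q]; [PSnoc p] is the path [p] followed by the arrow [a] *)
Inductive qpath v : vertex Q -> Type :=
| PNil : qpath v v
| PSnoc a : qpath v (source a) -> qpath v (target a).

Fixpoint pcat u v w (p : qpath u v) (q : qpath v w) : qpath u w :=
  match q with
  | PNil => p
  | PSnoc a q' => PSnoc (pcat p q')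
  end.

Definition parr a : qpath (source a) (target a) := PSnoc (PNil (source a)).

(* A morphism of the path category out of [x] which is not an [eta] between
   two points of the same thread factors through the vertex [leave x], and a
   morphism into [y] through [enter y]. *)
Definition leave (x : obj) : vertex Q :=
  match x with Vtx v => v | Pt a _ => target a end.
Definition enter (x : obj) : vertex Q :=
  match x with Vtx v => v | Pt a _ => source a end.

(* The distinct path-like elements from [x] to [y].
   [Through x y p] is [eta_{y,s(b)} p eta_{t(a),x}] if [x] and [y] are points
   of the threads of [a] and [b]; an [eta] at an end which is a vertex is
   dropped, being an identity (an [eta] from or to the other end of the
   thread is absorbed as an arrow in [p]).  [Eta x y _] is [eta_{yx}] for two
   points of one thread; in particular [eta_{xx} = e_x].  See [eta] and the
   lemmas on it below. *)
Inductive pathlike : obj -> obj -> Type :=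
| Through x y : qpath (leave x) (enter y) -> pathlike x y
| Eta a (x y : thread a) : (x <= y)%O -> pathlike (Pt x) (Pt y).

Definition plid (x : obj) : pathlike x x :=
  match x with
  | Vtx v => @Through (Vtx v) (Vtx v) (PNil v)
  | Pt a x => Eta (Order.POrderTheory.lexx x)
  end.

(* The path from [enter x] to [leave x] passing through [x]: trivial at a
   vertex, the arrow [a] at a point of the thread of [a]. *)
Definition across (x : obj) : qpath (enter x) (leave x) :=
  match x with Vtx v => PNil v | Pt a _ => parr a end.

(* precomposition with [Eta], by inversion on the source of [g] *)
Definition from_below (y z : obj) : Type :=
  match y with
  | Vtx _ => unit
  | Pt a y => forall x : thread a, (x <= y)%O -> pathlike (Pt x) z
  end.

Definition comp_eta y z (g : pathlike y z) : from_below y z :=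
  match g with
  | Through y z q =>
    match y return qpath (leave y) (enter z) -> from_below y z with
    | Vtx _ => fun=> tt
    | Pt a y => fun q x _ => @Through (Pt x) z q
    end q
  | Eta a y z yz => fun x xy => Eta (Order.POrderTheory.le_trans xy yz)
  end.

Definition comp_through x y z (g : pathlike y z) :
    qpath (leave x) (enter y) -> pathlike x z :=
  match g with
  | Through y z q => fun p => @Through x z (pcat p (pcat (across y) q))
  | Eta a y z _ => fun p => @Through x (Pt z) p
  end.

(* [plcomp g f] is [f] followed by [g] *)
Definition plcomp x y z (g : pathlike y z) (f : pathlike x y) :
    pathlike x z :=
  match f in pathlike x y return pathlike y z -> pathlike x z with
  | Through x y p => fun g => comp_through g p
  | Eta a x y xy => fun g => comp_eta g x xy
  end g.

Lemma pcat_nil u v (p : qpath u v) : pcat (PNil u) p = p.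
Proof. by elim: p => //= a p ->. Qed.

Lemma pcatA t u v w (p : qpath t u) (q : qpath u v) (r : qpath v w) :
  pcat p (pcat q r) = pcat (pcat p q) r.
Proof. by elim: r => //= a r ->. Qed.

Lemma Eta_irr a (x y : thread a) (h h' : (x <= y)%O) : Eta h = Eta h'.
Proof. by congr Eta; apply: bool_irrelevance. Qed.

Lemma plcomp1m x y (f : pathlike x y) : plcomp (plid y) f = f.
Proof. case: f => {x y} [x [v|a y] p|a x y h] //=; apply: Eta_irr. Qed.

Lemma plcompm1 x y (f : pathlike x y) : plcomp f (plid x) = f.
Proof.
case: f => {x y} [[v|a x] y p|a x y h] //=; last exact: Eta_irr.
by rewrite !pcat_nil.
Qed.

Lemma pathlike_Pt (P : forall a (x : thread a) z, pathlike (Pt x) z -> Prop) :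
  (forall a (x : thread a) z q, P a x z (@Through (Pt x) z q)) ->
  (forall a (x y : thread a) (h : (x <= y)%O), P a x (Pt y) (Eta h)) ->
  forall a (x : thread a) z (g : pathlike (Pt x) z), P a x z g.
Proof.
move=> P1 P2 a x z g.
pose R y z := match y return pathlike y z -> Prop with
  | Vtx _ => fun=> True | Pt a x => @P a x z end.
suff: R (Pt x) z g by [].
by case: g => {a x z} [[v|a x] z q|a x y h] //=.
Qed.

Lemma plcompA w x y z (h : pathlike y z) (g : pathlike x y)
    (f : pathlike w x) :
  plcomp h (plcomp g f) = plcomp (plcomp h g) f.
Proof.
case: f g => {w x} [w x p|a w x wx] g.
  case: g h p => {x y} [x y q|b x y xy] h p /=.
    case: h q => {y z} [y z r|b y z yz] q /=; last by [].
    by rewrite !pcatA.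
  by move: x xy p; elim/pathlike_Pt: h => {b y z} [b y z r|b y z yz] x xy p.
move: w wx h; elim/pathlike_Pt: g => {a x y} [a x y q|a x y xy] w wx h /=.
  by case: h q => {y z} [y z r|b y z yz] q.
move: w x xy wx.
by elim/pathlike_Pt: h => {a y z} [a y z r|a y z yz] w x xy wx //=; apply: Eta_irr.
Qed.

(* The thread of [a] with its two added ends. *)
Inductive bar a := BMin | BPt of thread a | BMax.
Arguments BMin {a}.
Arguments BMax {a}.

Definition bar_obj a (x : bar a) : obj :=
  match x with
  | BMin => Vtx (source a)
  | BPt x => Pt x
  | BMax => Vtx (target a)
  end.

Definition bar_le a (x y : bar a) : bool :=
  match x, y with
  | BMin, _ | _, BMax => true
  | BPt x, BPt y => (x <= y)%O
  | _, _ => false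
  end.

(* the path [p] of [Q] as a morphism *)
Definition plpath u v (p : qpath u v) : pathlike (Vtx u) (Vtx v) :=
  @Through (Vtx u) (Vtx v) p.

Definition eta a (x y : bar a) :
    bar_le x y -> pathlike (bar_obj x) (bar_obj y) :=
  match x, y return bar_le x y -> pathlike (bar_obj x) (bar_obj y) with
  | BMin, BMin => fun=> plid (Vtx (source a))
  | BMin, BPt y => fun=> @Through (Vtx (source a)) (Pt y) (PNil _)
  | BMin, BMax => fun=> plpath (parr a)
  | BPt x, BPt y => fun xy => Eta xy
  | BPt x, BMax => fun=> @Through (Pt x) (Vtx (target a)) (PNil _)
  | BMax, BMax => fun=> plid (Vtx (target a))
  | BPt _, BMin => fun xy => False_rect _ (notF xy)
  | BMax, BMin => fun xy => False_rect _ (notF xy)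
  | BMax, BPt _ => fun xy => False_rect _ (notF xy)
  end.

Lemma bar_le_trans a (y x z : bar a) : bar_le x y -> bar_le y z -> bar_le x z.
Proof.
by case: x y z => [|x|] [|y|] [|z|] //=; apply: Order.POrderTheory.le_trans.
Qed.

Lemma bar_le_max a (x : bar a) : bar_le x BMax.
Proof. by case: x. Qed.

Lemma eta_id a (x : bar a) (h : bar_le x x) : eta h = plid (bar_obj x).
Proof. by case: x h => //= x h; apply: Eta_irr. Qed.

Lemma eta_comp a (x y z : bar a) (xy : bar_le x y) (yz : bar_le y z) :
  plcomp (eta yz) (eta xy) = eta (bar_le_trans xy yz).
Proof.
by case: x y z xy yz => [|x|] [|y|] [|z|] //= xy yz; apply: Eta_irr.
Qed.

Lemma eta_max_min a : eta (isT : bar_le BMin BMax) = plpath (parr a).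
Proof. by []. Qed.

Lemma plcomp_path u v w (q : qpath v w) (p : qpath u v) :
  plcomp (plpath q) (plpath p) = plpath (pcat p q).
Proof. by rewrite /= pcat_nil. Qed.

Lemma Through_eta a b (x : thread a) (y : thread b)
    (p : qpath (target a) (source b)) :
  @Through (Pt x) (Pt y) p =
  plcomp (eta (isT : bar_le BMin (BPt y)))
    (plcomp (plpath p) (eta (isT : bar_le (BPt x) BMax))).
Proof. by rewrite /= !pcat_nil. Qed.

HB.instance Definition _ x y := gen_eqMixin (pathlike x y).
HB.instance Definition _ x y := gen_choiceMixin (pathlike x y).

End PathCategory.

Section LinearExtension.
Variables (k : fieldType) (K : choiceType) (V : lmodType k).
Local Notation "A `<=` B" := (fsubset A B).

(* the linear extension of [h] to the free module on [K] *)
Definition mlift (h : K -> V) (g : {malg k[K]}) : V :=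
  \sum_(x <- msupp g) g@_x *: h x.

Lemma mliftw (h : K -> V) (d : {fset K}) g : msupp g `<=` d ->
  mlift h g = \sum_(x <- d) g@_x *: h x.
Proof.
move=> gd; rewrite /mlift (big_fset_incl _ gd) // => x _ /mcoeff_outdom ->.
by rewrite scale0r.
Qed.

Lemma mlift_linear h a f g : mlift h (a *: f + g) = a *: mlift h f + mlift h g.
Proof.
pose d := (msupp f `|` msupp g)%fset.
have fd : msupp f `<=` d by apply: fsubsetUl.
have gd : msupp g `<=` d by apply: fsubsetUr.
have afgd : msupp (a *: f + g) `<=` d.
  apply: (fsubset_trans (msuppD_le _ _)); apply: fsetSU.
  exact: msuppZ_le.
rewrite (mliftw _ fd) (mliftw _ gd) (mliftw _ afgd) scaler_sumr -big_split /=.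
by apply: eq_bigr => x _; rewrite mcoeffD mcoeffZ scalerDl scalerA.
Qed.

HB.instance Definition _ h :=
  GRing.isLinear.Build k {malg k[K]} V _ (mlift h) (mlift_linear h).

Lemma mliftU h x : mlift h << x >> = h x.
Proof.
rewrite (@mliftw _ [fset x]%fset) ?msuppU_le // big_seq_fset1.
by rewrite mcoeffUU scale1r.
Qed.

Lemma eq_mlift h h' g : h =1 h' -> mlift h g = mlift h' g.
Proof. by move=> hh'; apply: eq_bigr => x _; rewrite hh'. Qed.

Lemma mlift_fun_linear a h h' g :
  mlift (fun x => a *: h x + h' x) g = a *: mlift h g + mlift h' g.
Proof.
rewrite /mlift scaler_sumr -big_split /=; apply: eq_bigr => x _.
by rewrite scalerDr !scalerA mulrC.
Qed.

End LinearExtension.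

Lemma mlift_mlift (k : fieldType) (K L : choiceType) (V : lmodType k)
    (h : L -> V) (h' : K -> {malg k[L]}) g :
  mlift h (mlift h' g) = mlift (fun x => mlift h (h' x)) g.
Proof.
rewrite [mlift h' g]/mlift linear_sum /=; apply: eq_bigr => x _.
by rewrite linearZ.
Qed.

Lemma mlift_id (k : fieldType) (K : choiceType) (g : {malg k[K]}) :
  mlift (fun x => << x >>) g = g.
Proof.
rewrite [RHS]monalgE; apply: eq_bigr => x _; apply/malgP => y.
by rewrite mcoeffZ !mcoeffU mulrnAr mulr1.
Qed.

Section LinearPathCategory.
Variables (k : fieldType) (Q : thread_quiver).
Implicit Types w x y z : obj Q.

Definition path_hom x y : lmodType k := {malg k[pathlike x y]}.

(* the bilinear extension of [plcomp] *)
Definition path_comp x y z (g : path_hom y z) (f : path_hom x y) :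
    path_hom x z :=
  mlift (fun q => mlift (fun p => << plcomp q p >>) f) g.

Lemma path_compU x y z (q : pathlike y z) (p : pathlike x y) :
  path_comp << q >> << p >> = << plcomp q p >>.
Proof. by rewrite /path_comp !mliftU. Qed.

Lemma path_comp1m x y (f : path_hom x y) : path_comp << plid y >> f = f.
Proof.
rewrite /path_comp mliftU -[RHS]mlift_id; apply: eq_mlift => p.
by rewrite plcomp1m.
Qed.

Lemma path_compm1 x y (f : path_hom x y) : path_comp f << plid x >> = f.
Proof.
rewrite /path_comp -[RHS]mlift_id; apply: eq_mlift => p.
by rewrite mliftU plcompm1.
Qed.

Lemma path_compA w x y z (h : path_hom y z) (g : path_hom x y)
    (f : path_hom w x) :
  path_comp h (path_comp g f) = path_comp (path_comp h g) f.
Proof.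
rewrite /path_comp mlift_mlift; apply: eq_mlift => r.
rewrite !mlift_mlift; apply: eq_mlift => q.
rewrite mlift_mlift mliftU; apply: eq_mlift => p.
by rewrite mliftU plcompA.
Qed.

Lemma path_compPl x y z a (g g' : path_hom y z) (f : path_hom x y) :
  path_comp (a *: g + g') f = a *: path_comp g f + path_comp g' f.
Proof. exact: mlift_linear. Qed.

Lemma path_compPr x y z a (g : path_hom y z) (f f' : path_hom x y) :
  path_comp g (a *: f + f') = a *: path_comp g f + path_comp g f'.
Proof.
rewrite /path_comp -mlift_fun_linear; apply: eq_mlift => q.
exact: mlift_linear.
Qed.

Definition path_cat : lincat k (obj Q) :=
  @Lincat k (obj Q) path_hom (fun x => << plid x >>) path_comp
    path_comp1m path_compm1 path_compA path_compPl path_compPr.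

(** * Pointwise finite-dimensional representations *)

Definition rep : Type := linfunctor path_cat (fdvect k).

Definition rep_pwf : lincat k rep := functor_cat path_cat (fdvect k).

Definition supp (M : rep) (x : obj Q) : Prop :=
  \dim {: (M x : vectType k)} <> 0%N.

Definition noise (M : rep) : Prop := forall v : vertex Q, ~ supp M (Vtx v).

Definition noise_free (M : rep) : Prop :=
  forall N, direct_summand rep_pwf N M -> noise N -> is_zero rep_pwf N.

Definition supp_in_thread (M : rep) (a : arrow Q) : Prop :=
  forall x, supp M x -> exists p : thread a, x = Pt p.

Definition finite_sum_indec (M : rep) : Prop :=
  exists n (V : 'I_n -> rep),
    (forall i, indecomposable rep_pwf (V i)) /\ direct_sum_fam rep_pwf V M.

(* The decomposition [M = MNF (+) W] with [W] the direct sum of the [U a] is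
   unique up to isomorphism of the summands, so it does not matter which one
   is taken.  The [U a] have disjoint supports: their pointwise direct sum is
   pointwise finite-dimensional, and is their coproduct in [rep_pwf]. *)
Definition quasi_noise_free (M : rep) : Prop :=
  exists (MNF W : rep) (U : arrow Q -> rep),
    [/\ direct_sum rep_pwf MNF W M, direct_sum_fam rep_pwf U W, noise_free MNF,
        forall a, supp_in_thread (U a) a
      & forall a, finite_sum_indec (U a)].

Definition rep_qnf : lincat k {M : rep | quasi_noise_free M} :=
  full_subcat rep_pwf quasi_noise_free.

End LinearPathCategory.

(* Main.v *)
(* Restrict [M] to the thread of an arrow [a] together with its two ends.  The
   noise at [x] is [ker (M x -> M max)] modulo its intersection with the image
   of [M min], and [M] is quasi noise free iff, for every [a], the number [cnt]
   of intervals in the restrictions of [M] to finite chains of that thread is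
   bounded.  This number is monotone under sub- and quotient objects and
   subadditive on extensions (the intervals of a finite chain are counted by
   socles, or equally by tops), so the bounded [M] form a Serre subcategory.

   That the criterion holds rests on one splitting statement: if there is noise
   at [x], then an interval supported in the open thread splits off.  Comparing
   the finite filtrations of [M x] by images and by kernels gives a vector and a
   linear form with a common birth and death; they extend to a compatible
   family of vectors, resp. of forms, because an inverse system of affine
   spaces of finite dimension over a total order has a compatible family. *)
From HB Require Import structures.
From mathcomp Require Import all_boot all_order all_algebra.
From mathcomp Require Import finmap.
From mathcomp Require Import boolp classical_sets.
From mathcomp.multinomials Require Import monalg.
Require Import Defs.

Set Implicit Arguments.
Unset Strict Implicit.
Unset Printing Implicit Defensive.

Import GRing.Theory.
Local Open Scope ring_scope.

(** The obstacle is that noise freeness passes neither to subobjects nor to quotients: an interval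
    module starting at [min] and dying inside the thread contains noise, and one reaching [max] has
    noise as a quotient. A decomposition cannot be carried along a morphism, but a bound on a number
    can. A noise free part satisfies such a bound because each of its intervals reaches an end of
    the thread, and at most dim M(min) + dim M(max) intervals do. Conversely, each interval split
    off lowers the bound by one, so splitting stops with a finite sum and a complement without
    noise. No decomposition theorem for representations of an infinite chain enters: one summand at
    a time is enough. The interval has to avoid both ends because an endomorphism of the restriction
    to one thread extends by zero to all of [M] once it vanishes at the ends: every morphism into or
    out of the open thread passes through one of them. *)

(** * Extremal choices and linear algebra *)

(** With [d] a dimension, this replaces finiteness of a filtration: in a totally ordered family of
    subspaces indexed by an infinite chain, an extremal dimension singles out the smallest or the
    largest member. *)
Lemma ex_argmin (T : Type) (P : T -> Prop) (d : T -> nat) :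
  (exists x, P x) -> exists2 x, P x & forall y, P y -> (d x <= d y)%N.
Proof.
case=> x Px.
have ex : exists n, `[< exists2 y, P y & d y = n >].
  by exists (d x); apply/asboolP; exists x.
case: (ex_minnP ex) => n /asboolP [y Py <-] min_n.
by exists y => // z Pz; apply: min_n; apply/asboolP; exists z.
Qed.

Lemma ex_argmax (T : Type) (P : T -> Prop) (d : T -> nat) N :
  (forall x, (d x <= N)%N) ->
  (exists x, P x) -> exists2 x, P x & forall y, P y -> (d y <= d x)%N.
Proof.
move=> dN /(ex_argmin (fun x => N - d x)%N) [x Px min_x]; exists x => // y Py.
by have := min_x y Py; rewrite leq_sub2lE.
Qed.

Lemma dimvf_eq0P (k : fieldType) (V : vectType k) :
  \dim {:V} = 0%N <-> forall v : V, v = 0.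
Proof.
split=> [/eqP V0 v|V0].
  by apply/eqP; rewrite -memv0 -(eqP (_ : fullv == 0)%VS) ?memvf // -dimv_eq0.
apply/eqP; rewrite dimv_eq0 -subv0; apply/subvP => v _.
by rewrite [v]V0 mem0v.
Qed.

Section Quotient.
Variables (k : fieldType) (V : vectType k) (W : {vspace V}).

(** The projection onto [W^C] along [W]: the quotient map by [W], realised inside [V]. *)
Definition quov : 'End(V) := daddv_pi W^C W.

Lemma quov_sub v : v - quov v \in W.
Proof.
have CW : (W^C :&: W = 0)%VS by rewrite capvC capv_compl.
have CWf : (W^C + W = fullv)%VS by rewrite addvC addv_complf.
rewrite -{1}[v](daddv_pi_add CW) ?CWf ?memvf //.
by rewrite addrAC addrN add0r memv_pi.
Qed.

Lemma quov_eq0 v : (quov v == 0) = (v \in W).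
Proof.
apply/eqP/idP => [q0|vW]; first by have := quov_sub v; rewrite q0 subr0.
apply/eqP; rewrite -memv0 -(capv_compl W) memv_cap memv_pi andbT.
have -> : quov v = v - (v - quov v) by rewrite subKr.
by rewrite memvB ?quov_sub.
Qed.

(** Some coordinate of [quov v] is nonzero; composed with [quov] and rescaled it is the form. *)
Lemma separating_form v :
  v \notin W -> exists2 phi : 'Hom(V, k^o), phi v = 1 & (W <= lker phi)%VS.
Proof.
rewrite -quov_eq0 => u0.
have [i ci] : exists i, coord (vbasis {:V}) i (quov v) != 0.
  apply/existsP; apply: contraNT u0; rewrite negb_exists => /forallP c0.
  rewrite (coord_vbasis (memvf (quov v))) big1 // => i _.
  by move: (c0 i); rewrite negbK => /eqP ->; rewrite scale0r.
pose c : 'Hom(V, k^o) := linfun (coord (vbasis {:V}) i : V -> k^o).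
exists ((c (quov v))^-1 *: (c \o quov)%VF).
  by rewrite scale_lfunE comp_lfunE lfunE; apply: mulVf.
apply/subvP => w; rewrite -quov_eq0 memv_ker => /eqP w0.
by rewrite scale_lfunE comp_lfunE w0 linear0 scaler0.
Qed.

End Quotient.

(** * Representations of an ordered index set; compatible lifts of vectors and forms *)

(** The maps are total in [i] and [j] and composition is constrained only along [le], so that no
    proof of [le i j] has to be carried as an argument. *)
Record pmod (k : fieldType) (I : Type) (le : rel I) := PMod {
  pm_obj :> I -> vectType k;
  pm_map : forall i j, 'Hom(pm_obj i, pm_obj j);
  pm_id : forall i, pm_map i i = \1%VF;
  pm_comp : forall i j l, le i j -> le j l ->
    (pm_map j l \o pm_map i j)%VF = pm_map i l }.

Section CompatibleLift.
Variables (k : fieldType) (I : Type) (le : rel I) (E : pmod k le).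
Hypotheses (le_refl : reflexive le) (le_trans : transitive le)
  (le_total : total le).
Variables (t : I) (v : E t).
Hypotheses (let_ : forall i, le i t) (v0 : v != 0).
Hypothesis v_img : forall i, v \in limg (pm_map E i t).

Local Notation f := (pm_map E).

Let pm_compE i j l (u : E i) : le i j -> le j l -> f j l (f i j u) = f i l u.
Proof. by move=> ij jl; rewrite -comp_lfunE pm_comp. Qed.

Let pm_idE i (u : E i) : f i i u = u.
Proof. by rewrite pm_id id_lfunE. Qed.

Let img_comp i j l U : le i j -> le j l ->
  (f j l @: (f i j @: U))%VS = (f i l @: U)%VS.
Proof. by move=> ij jl; rewrite -limg_comp pm_comp. Qed.

(** A linear stand-in for an inverse system of nonempty affine fibres over [v]: the vectors of [S i]
    above [v] form such a fibre. *)
Definition lifting (S : forall i, {vspace E i}) : Prop :=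
  (forall i j, le i j -> (f i j @: S i <= S j)%VS) /\
  (forall i, v \in (f i t @: S i)%VS).

(** Zorn for reversed inclusion. A nonempty chain is bounded by its pointwise intersections; by
    finite dimension each of these is attained by a member of the chain, so its image still contains
    [v]. *)
Lemma ex_minimal_lifting : exists2 S, lifting S &
  forall S', lifting S' -> (forall i, (S' i <= S i)%VS) -> S' = S.
Proof.
pose T := {S | lifting S}.
pose R (S S' : T) := `[< forall i, (sval S' i <= sval S i)%VS >].
have [|r s u|s u||S max_S] := @Zorn T R.
- by move=> S; apply/asboolP => i; apply: subvv.
- move=> /asboolP rs /asboolP su; apply/asboolP => i.
  exact: subv_trans (su i) (rs i).
- move=> /asboolP su /asboolP us; case: s u su us => [s hs] [u hu] /= su us.
  have {}su : s = u.
    apply: functional_extensionality_dep => i; apply/eqP.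
    by rewrite eqEsubv us su.
  by subst u; congr exist; apply: Prop_irrelevance.
- move=> C totC; have [[S0 C0]|nC] := pselect (exists S, C S); last first.
    (* The empty chain is bounded by the full spaces, which are a lifting by [v_img]. *)
    have lif : lifting (fun i => fullv).
      by split=> [i j _|i]; [apply: subvf|apply: v_img].
    by exists (exist _ _ lif) => S CS; case: nC; exists S.
  have /choice [c cP] : forall i, exists S : T, C S /\
      forall S' : T, C S' -> (sval S i <= sval S' i)%VS.
    move=> i; have [S CS minS] := ex_argmin (fun S : T => \dim (sval S i))
      (ex_intro C S0 C0).
    exists S; split=> // S' CS'.
    have [/asboolP SS'|/asboolP/(_ i) //] := totC _ _ CS CS'.
    by have /eqP <- : sval S' i == sval S i by rewrite eqEdim SS' minS.
  have lif : lifting (fun i => sval (c i) i).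
    split=> [i j ij|i]; last by case: (svalP (c i)) => _; apply.
    have [Ci ci] := cP i; have [Cj cj] := cP j.
    apply: subv_trans (limgS _ (ci _ Cj)) _.
    by case: (svalP (c j)) => /(_ i j ij).
  exists (exist _ _ lif) => S CS; apply/asboolP => i /=.
  by have [_] := cP i; apply.
- exists (sval S); first exact: svalP.
  move=> S' lS' S'S; have /max_S <- // : R S (exist _ _ lS') by apply/asboolP.
Qed.

(* In a minimal lifting every transition map is onto; restricting it to the
   preimages of a line then shows that it is made of lines. *)
Lemma compatible_lift : exists w : forall i, E i,
  w t = v /\ forall i j, le i j -> f i j (w i) = w j.
Proof.
have [S [S_st S_v] minS] := ex_minimal_lifting.
have S_onto i j : le i j -> (f i j @: S i)%VS = S j.
  (* [c j] is an index from which the image in [E j] is as small as possible. These stable images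
     form a lifting inside [S], hence equal [S], and every transition map is onto. *)
  have /choice [c cP] : forall j, exists i, le i j /\
      forall l, le l j -> (f i j @: S i <= f l j @: S l)%VS.
    move=> {}j; have [{}i ij mini] := ex_argmin
      (fun i => \dim (f i j @: S i)) (ex_intro (fun i => le i j) j (le_refl j)).
    exists i; split=> // l lj.
    have /orP [il|li] := le_total i l.
      by rewrite -(img_comp _ il lj); apply/limgS/S_st.
    have sub : (f l j @: S l <= f i j @: S i)%VS.
      by rewrite -(img_comp _ li ij); apply/limgS/S_st.
    suff /eqP <- : (f l j @: S l == f i j @: S i)%VS by exact: subvv.
    by rewrite eqEdim sub mini.
  have S'S : (fun j => f (c j) j @: S (c j))%VS = S.
    apply: minS => [|{}j]; last by apply: S_st; case: (cP j).
    split=> [{}i {}j ij|{}i].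
      have [ci _] := cP i; have [cj _] := cP j.
      have /orP [ji|ij'] := le_total (c j) i.
        rewrite -(img_comp _ ji ij); apply: limgS.
        by have [_] := cP i; apply.
      rewrite (img_comp _ ci ij) -(img_comp _ (le_trans ci ij') cj).
      exact/limgS/S_st/(le_trans ci ij').
    by have [ci _] := cP i; rewrite img_comp.
  move=> ij; apply/eqP; rewrite eqEsubv S_st //=.
  rewrite -{1}(congr1 (fun S => S j) S'S) /=.
  by have [_] := cP j; apply.
have lineS j p : p \in S j -> f j t p = v -> S j = <[p]>%VS.
  move=> Sp pv.
  pose S' i := if le i j then (S i :&: f i j @^-1: <[p]>)%VS
               else (f j i @: <[p]>)%VS.
  have S'j : S' j = <[p]>%VS.
    rewrite /S' le_refl; apply/eqP; rewrite eqEsubv; apply/andP; split.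
      by apply/subvP => u /memv_capP [_]; rewrite -memv_preim pm_idE.
    by rewrite -memvE memv_cap Sp -memv_preim pm_idE memv_line.
  have p_S' : p \in S' j by rewrite S'j memv_line.
  suff <- : S' = S by [].
  have nle i : ~~ le i j -> le j i by have := le_total i j; case: (le i j).
  apply: minS => [|i]; last first.
    rewrite /S'; case: ifP => [_|/negbT/nle ji]; first exact: capvSl.
    by rewrite -(S_onto _ _ ji); apply: limgS; rewrite -memvE.
  split=> [i l il|i].
    rewrite /S'; case: ifP => [ij|/negbT/nle ji]; case: ifP => [lj|/negbT nlj].
    - apply/subvP => _ /memv_imgP [u /memv_capP [uS uj] ->].
      rewrite memv_cap (subvP (S_st _ _ il)) ?memv_img //=.
      by rewrite -memv_preim pm_compE // memv_preim.
    - apply/subvP => _ /memv_imgP [u /memv_capP [uS uj] ->].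
      by rewrite -(pm_compE _ ij (nle _ nlj)) memv_img // memv_preim.
    - have ii : le l l by apply: le_refl.
      apply/subvP => _ /memv_imgP [_ /memv_imgP [u up ->] ->].
      rewrite pm_compE // memv_cap -memv_preim.
      rewrite pm_compE ?(le_trans ji il) // pm_idE up andbT.
      apply: (subvP (S_st _ _ (le_trans ji il))); apply: memv_img.
      by have /vlineP [a ->] := up; apply: memvZ.
    - by rewrite img_comp.
  rewrite /S'; case: ifP => [ij|/negbT/nle ji].
    have : p \in (f i j @: S i)%VS by rewrite S_onto.
    case/memv_imgP => u uS pu; apply/memv_imgP; exists u.
      by rewrite memv_cap uS -memv_preim -pu memv_line.
    by rewrite -pv pu pm_compE.
  by rewrite img_comp // limg_line pv memv_line.
have ex_w i : exists p, p \in S i /\ f i t p = v.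
  by have /memv_imgP [p pS ->] := S_v i; exists p.
pose w i := sval (cid (ex_w i)).
have wP i : w i \in S i /\ f i t (w i) = v by rewrite /w; case: cid.
exists w; split=> [|i j ij].
  by have [_] := wP t; rewrite pm_idE.
have [wi wiv] := wP i; have [wj wjv] := wP j.
have : f i j (w i) \in S j by rewrite (subvP (S_st _ _ ij)) ?memv_img.
rewrite (lineS _ _ wj wjv) => /vlineP [a fa].
(* Both [w j] and its multiple by [a] map to [v], and [v] is nonzero, so [a = 1]. *)
have : f j t (f i j (w i)) = v by rewrite pm_compE.
rewrite fa linearZ /= wjv => /eqP.
rewrite -subr_eq0 -[X in _ - X]scale1r -scalerBl scaler_eq0 (negPf v0) orbF.
by rewrite subr_eq0 => /eqP ->; rewrite scale1r.
Qed.

End CompatibleLift.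

Section RestrictDual.
Variables (k : fieldType) (I : Type) (le : rel I) (E : pmod k le).

Program Definition pm_restrict (D : I -> Prop) :
    pmod k (fun i j : {i | D i} => le (sval i) (sval j)) :=
  @PMod k _ _ (fun i => E (sval i)) (fun i j => pm_map E (sval i) (sval j)) _ _.
Next Obligation. exact: pm_id. Qed.
Next Obligation. exact: pm_comp. Qed.

Definition precomp (U V W : vectType k) (g : 'Hom(U, V)) (phi : 'Hom(V, W)) :
  'Hom(U, W) := (phi \o g)%VF.

Lemma precomp_linear (U V W : vectType k) (g : 'Hom(U, V)) :
  linear (@precomp U V W g).
Proof. by move=> a u v; rewrite /precomp comp_lfunDl -comp_lfunZl. Qed.

HB.instance Definition _ (U V W : vectType k) (g : 'Hom(U, V)) :=
  GRing.isLinear.Build k 'Hom(V, W) 'Hom(U, W) _ (@precomp U V W g)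
    (@precomp_linear U V W g).

Program Definition pm_dual : pmod k (fun i j => le j i) :=
  @PMod k I (fun i j => le j i) (fun i => 'Hom(E i, k^o))
    (fun i j => linfun (precomp (pm_map E j i))) _ _.
Next Obligation.
by apply/lfunP => u; rewrite lfunE /= /precomp pm_id comp_lfun1r id_lfunE.
Qed.
Next Obligation.
by apply/lfunP => u; rewrite comp_lfunE !lfunE /= /precomp -comp_lfunA pm_comp.
Qed.

End RestrictDual.

Section LiftOn.
Variables (k : fieldType) (I : Type) (le : rel I).
Hypotheses (le_refl : reflexive le) (le_trans : transitive le)
  (le_total : total le).

Lemma compatible_lift_on (E : pmod k le) (D : I -> Prop) t (v : E t) :
  D t -> (forall i, D i -> le i t) -> v != 0 ->
  (forall i, D i -> v \in limg (pm_map E i t)) ->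
  exists w : forall i, E i, w t = v /\
    forall i j, D i -> D j -> le i j -> pm_map E i j (w i) = w j.
Proof.
move=> Dt let_ v0 v_img.
have [||||||w [wt w_st]] := @compatible_lift k {i | D i} _
  (pm_restrict E D) _ _ _
  (exist _ t Dt) v.
- by move=> i; apply: le_refl.
- by move=> i j l; apply: le_trans.
- by move=> i j; apply: le_total.
- by case.
- by [].
- by case.
pose w' i : E i := if pselect (D i) is left d then w (exist _ i d) else 0.
have w'E i (d : D i) : w' i = w (exist _ i d).
  by rewrite /w'; case: pselect => // d'; rewrite (Prop_irrelevance d' d).
exists w'; split=> [|i j Di Dj ij]; first by rewrite w'E.
by rewrite !w'E; apply: (w_st (exist _ i Di) (exist _ j Dj)).
Qed.

End LiftOn.

(** The lifting result for [pm_dual] and the reversed order. A form comes from [E i] exactly when it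
    kills the kernel of the map to [E i], which turns the image condition into a kernel
    condition. *)
Lemma compatible_colift_on (k : fieldType) (I : Type) (le : rel I)
    (le_refl : reflexive le) (le_trans : transitive le) (le_total : total le)
    (E : pmod k le) (D : I -> Prop) t (phi : 'Hom(E t, k^o)) :
  D t -> (forall i, D i -> le t i) -> phi != 0 ->
  (forall i, D i -> (lker (pm_map E t i) <= lker phi)%VS) ->
  exists psi : forall i, 'Hom(E i, k^o), psi t = phi /\
    forall i j, D i -> D j -> le i j -> (psi j \o pm_map E i j)%VF = psi i.
Proof.
move=> Dt tle phi0 ker_phi.
have [|||||||psi [psit psi_st]] := @compatible_lift_on k I (fun i j => le j i)
  _ _ _ (pm_dual E) D t phi.
- exact: le_refl.
- by move=> j i l ij jl; apply: le_trans jl ij.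
- by move=> i j; rewrite orbC; apply: le_total.
- exact: Dt.
- exact: tle.
- exact: phi0.
- move=> i Di; set g := pm_map E t i.
  (* [g^-1] is a section of [g] on its image only; [u] and its image under [g^-1 \o g] differ by an
     element of the kernel of [g], on which [phi] vanishes. *)
  apply/memv_imgP; exists (phi \o g^-1)%VF; first exact: memvf.
  rewrite lfunE /= /precomp; apply/lfunP => u.
  rewrite !comp_lfunE; apply/eqP; rewrite -subr_eq0 -linearB -memv_ker.
  apply: (subvP (ker_phi i Di)).
  by rewrite memv_ker linearB /= limg_lfunVK ?memv_img ?memvf // subrr.
exists psi; split=> // i j Di Dj ij.
by rewrite -(psi_st j i Dj Di ij) lfunE.
Qed.

Section RankOne.
Variables (k : fieldType) (V : vectType k).

Definition scale_line (v : V) (a : k^o) : V := (a : k) *: v.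

Lemma scale_line_linear v : linear (scale_line v).
Proof. by move=> a b c; rewrite /scale_line scalerDl scalerA. Qed.

HB.instance Definition _ v :=
  GRing.isLinear.Build k k^o V _ (scale_line v) (scale_line_linear v).

Definition rank_one (phi : 'Hom(V, k^o)) v : 'End(V) :=
  (linfun (scale_line v) \o phi)%VF.

Lemma rank_oneE phi v u : rank_one phi v u = (phi u : k) *: v.
Proof. by rewrite /rank_one comp_lfunE lfunE. Qed.

Lemma limg_rank_one phi v : (limg (rank_one phi v) <= <[v]>)%VS.
Proof.
apply/subvP => _ /memv_imgP [u _ ->]; rewrite rank_oneE.
by apply/vlineP; exists (phi u).
Qed.

End RankOne.

(** * Splitting off one interval *)

Section IntervalSummand.
Variables (k : fieldType) (I : Type) (le : rel I) (E : pmod k le).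
Hypotheses (le_refl : reflexive le) (le_trans : transitive le)
  (le_total : total le).
Variables (bot top : I).
Hypotheses (bot_le : forall i, le bot i) (le_top : forall i, le i top).

Local Notation f := (pm_map E).

Let pm_compE i j l (u : E i) : le i j -> le j l -> f j l (f i j u) = f i l u.
Proof. by move=> ij jl; rewrite -comp_lfunE pm_comp. Qed.

Let pm_idE i (u : E i) : f i i u = u.
Proof. by rewrite pm_id id_lfunE. Qed.

Let img_mono i j l : le i j -> le j l -> (limg (f i l) <= limg (f j l))%VS.
Proof.
move=> ij jl; apply/subvP => _ /memv_imgP [u _ ->].
by rewrite -(pm_compE _ ij jl) memv_img ?memvf.
Qed.

Let ker_mono i j l : le i j -> le j l -> (lker (f i j) <= lker (f i l))%VS.
Proof.
move=> ij jl; apply/subvP => u; rewrite !memv_ker -(pm_compE _ ij jl).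
by move=> /eqP ->; rewrite linear0.
Qed.

Variable x0 : I.
Local Notation img x := (limg (f x x0)).
Local Notation ker x := (lker (f x0 x)).
Hypothesis noisy : ~~ (ker top <= img bot)%VS.

(** For [x] below [x0]: some vector of [E x0] that dies at [top] and does not come from [bot] comes
    already from [x]. Below [x0] this is an up-closed condition, true at [x0] and false at [bot]. *)
Definition born_late x := ~~ (img x :&: ker top <= img bot)%VS.

(* [A'] and [A] are consecutive among the images in [E x0], [B'] and [B] among
   the kernels; an element of [A :&: B] outside [A' + B'] belongs to an
   interval with a fixed birth and a fixed death. *)
Lemma noisy_vector :
  exists (died : pred I) (v : E x0) (phi : 'Hom(E x0, k^o)),
  [/\ phi v = 1,
    (forall x, le x x0 -> if born_late x then v \in img x
                          else (img x <= lker phi)%VS),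
    (forall y, le x0 y -> if died y then v \in ker y
                          else (ker y <= lker phi)%VS),
    [/\ ~~ born_late bot, born_late x0, ~~ died x0 & died top]
  & (forall x y, le x y -> le y x0 -> born_late x -> born_late y) /\
    (forall x y, le x0 x -> le x y -> died x -> died y) ].
Proof.
have late_mono x y : le x y -> le y x0 -> born_late x -> born_late y.
  move=> xy yx0; apply: contraNN => /(subv_trans _); apply.
  by apply: capvS => //; apply: img_mono.
have late_bot : ~~ born_late bot by rewrite negbK capvSl.
have late_x0 : born_late x0 by rewrite /born_late pm_id lim1g capfv.
have [x1 [x1x0 late1] min1] := ex_argmin (fun x => \dim (img x))
  (ex_intro (fun x => le x x0 /\ born_late x) x0 (conj (le_refl x0) late_x0)).
have [||x2 [x2x0 late2] max2] := @ex_argmax I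
  (fun x => le x x0 /\ ~~ born_late x) (fun x => \dim (img x)) (\dim {:E x0}).
- by move=> x; apply/dimvS/subvf.
- by exists bot; split.
set A := img x1 in min1; set A' := img x2 in max2.
have A_min x : le x x0 -> born_late x -> (A <= img x)%VS.
  move=> xx0 late; have /orP [x1x|xx1] := le_total x1 x; first exact: img_mono.
  suff /eqP <- : img x == A by exact: subvv.
  by rewrite eqEdim img_mono //= min1.
have A'_max x : le x x0 -> ~~ born_late x -> (img x <= A')%VS.
  move=> xx0 late; have /orP [xx2|x2x] := le_total x x2; first exact: img_mono.
  suff /eqP <- : A' == img x by exact: subvv.
  by rewrite eqEdim img_mono //= max2.
have A'A : (A' <= A)%VS.
  have /orP [x2x1|x1x2] := le_total x2 x1; first exact: img_mono.
  by case/negP: late2; apply: late_mono late1.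
(* Death is measured on [A] modulo [A'] and not on all of [E x0]: it has to concern vectors with the
   birth just fixed. *)
pose died y := ~~ (A :&: ker y <= A')%VS.
have died_mono x y : le x0 x -> le x y -> died x -> died y.
  move=> x0x xy; apply: contraNN => /(subv_trans _); apply.
  by apply: capvS => //; apply: ker_mono.
have died_x0 : ~~ died x0.
  rewrite negbK pm_id; apply/subvP => u.
  by rewrite memv_cap memv_ker id_lfunE => /andP [_ /eqP ->]; apply: mem0v.
have died_top : died top.
  apply: contraNN late1 => AK; move: late2; rewrite negbK; apply: subv_trans.
  by rewrite subv_cap AK capvSr.
have [y1 [x0y1 died1] min2] := ex_argmin (fun y => \dim (ker y))
  (ex_intro (fun y => le x0 y /\ died y) top (conj (le_top x0) died_top)).
have [||y2 [x0y2 died2] max3] := @ex_argmax I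
  (fun y => le x0 y /\ ~~ died y) (fun y => \dim (ker y)) (\dim {:E x0}).
- by move=> y; apply/dimvS/subvf.
- by exists x0; split.
set B := ker y1 in min2; set B' := ker y2 in max3.
have B_min y : le x0 y -> died y -> (B <= ker y)%VS.
  move=> x0y d; have /orP [y1y|yy1] := le_total y1 y; first exact: ker_mono.
  suff /eqP <- : ker y == B by exact: subvv.
  by rewrite eqEdim ker_mono //= min2.
have B'_max y : le x0 y -> ~~ died y -> (ker y <= B')%VS.
  move=> x0y d; have /orP [yy2|y2y] := le_total y y2; first exact: ker_mono.
  suff /eqP <- : B' == ker y by exact: subvv.
  by rewrite eqEdim ker_mono //= max3.
(* Otherwise the modular law, with [A'] inside [A], puts the intersection of [A] and [B] into the
   sum of [A'] and the intersection of [A] with [B']. The latter lies in [A'] since [y2] has not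
   died, which contradicts [died y1]. *)
have [v] : exists2 v, v \in (A :&: B)%VS & v \notin (A' + B')%VS.
  apply/subvPn; apply: contraNN died1 => AB; apply/subvP => u uAB.
  have /memv_addP [a aA' [b bB' uab]] := subvP AB _ uAB.
  have bE : b = u - a by rewrite uab addrC addKr.
  have bA : b \in A.
    by have /memv_capP [uA _] := uAB; rewrite bE memvB // (subvP A'A).
  rewrite uab memvD //; move: died2; rewrite negbK => /subvP; apply.
  by rewrite memv_cap bA.
rewrite memv_cap => /andP [vA vB] /separating_form [phi phiv].
rewrite subv_add => /andP [kA' kB'].
exists died, v, phi; split=> // [x xx0|y x0y].
  case: ifP => [late|/negbT late]; first exact: (subvP (A_min _ xx0 late)).
  exact: subv_trans (A'_max _ xx0 late) kA'.
case: ifP => [d|/negbT d]; first exact: (subvP (B_min _ x0y d)).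
exact: subv_trans (B'_max _ x0y d) kB'.
Qed.

(** On the interval [J] of life of [v] there are compatible vectors [V x] and forms [F x] with
    [F x (V x) = 1], and [h x] is the projection [F x u *: V x]. It commutes with maps leaving [J]
    because [v] dies there, and with maps entering [J] because [phi] kills whatever was born
    earlier. The last two clauses say that the image is an interval module, in the form that
    [cnt_thin] uses. *)
Lemma interval_summand : exists h : forall i, 'End(E i),
  [/\ forall i j, le i j -> (h j \o f i j = f i j \o h i)%VF,
      forall i, (h i \o h i = h i)%VF,
      [/\ h bot = 0, h top = 0 & h x0 != 0],
      forall i, (\dim (limg (h i)) <= 1)%N
    & forall i j, le i j -> h i != 0 -> h j != 0 ->
        (limg (h i) :&: lker (f i j) = 0)%VS].
Proof.
have [died [v [phi [phiv]]]] := noisy_vector.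
move=> v_img v_ker [late_bot late_x0 died_x0 died_top] [late_mono died_mono].
have v0 : v != 0.
  by apply: contra_eq_neq phiv => ->; rewrite linear0 eq_sym oner_neq0.
have phi0 : phi != 0.
  by apply: contra_eq_neq phiv => ->; rewrite zero_lfunE eq_sym oner_neq0.
have [|||||||w [wx0 w_st]] := @compatible_lift_on k I le _ _ _ E
  (fun x => le x x0 /\ born_late x) x0 v => //.
- by move=> x [].
- by move=> x [xx0 late]; have := v_img x xx0; rewrite late.
have [|||||||psi [psix0 psi_st]] := @compatible_colift_on k I le _ _ _ E
  (fun x => le x0 x /\ ~~ died x) x0 phi => //.
- by move=> x [].
- by move=> x [x0x d]; have := v_ker x x0x; rewrite (negPf d).
pose J x := (le x x0 ==> born_late x) && (le x0 x ==> ~~ died x).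
(* [V] lifts [v] below [x0] and pushes it forward elsewhere; [F] extends [phi] above [x0] and pulls
   it back elsewhere. *)
pose V x := if le x x0 then w x else f x0 x v.
pose F x := if le x0 x then psi x else (phi \o f x x0)%VF.
have nle x y : ~~ le x y -> le y x by have := le_total x y; case: (le x y).
have Jlow x : J x -> le x x0 -> born_late x.
  by rewrite /J => /andP [+ _] => /implyP.
have Jup x : J x -> le x0 x -> ~~ died x.
  by rewrite /J => /andP [_ /implyP].
have Vx0 x : J x -> le x x0 -> f x x0 (V x) = v.
  by move=> Jx xx0; rewrite /V xx0 w_st ?wx0 //; split=> //; apply: Jlow.
have Fx0 x : J x -> le x0 x -> (F x \o f x0 x)%VF = phi.
  by move=> Jx x0x; rewrite /F x0x psi_st ?psix0 //; split=> //; apply: Jup.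
have Vup x y : J x -> le x y -> le x0 y -> f x y (V x) = f x0 y v.
  move=> Jx xy x0y; have [xx0|/[dup] xx0 /nle x0x] := boolP (le x x0).
    by rewrite -(pm_compE _ xx0 x0y) Vx0.
  by rewrite /V (negPf xx0) pm_compE.
have Flow x y : J y -> le x y -> le x x0 -> (F y \o f x y = phi \o f x x0)%VF.
  move=> Jy xy xx0; have [x0y|/[dup] x0y /nle yx0] := boolP (le x0 y).
    by rewrite -(pm_comp E xx0 x0y) comp_lfunA Fx0.
  by rewrite /F (negPf x0y) -comp_lfunA pm_comp.
have VV x y : J x -> J y -> le x y -> f x y (V x) = V y.
  move=> Jx Jy xy; have [yx0|/[dup] yx0 /nle x0y] := boolP (le y x0).
    have xx0 := le_trans xy yx0.
    by rewrite /V yx0 xx0 w_st //; split=> //; apply: Jlow.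
  by rewrite Vup // /V (negPf yx0).
have FF x y : J x -> J y -> le x y -> (F y \o f x y)%VF = F x.
  move=> Jx Jy xy; have [x0x|/[dup] x0x /nle xx0] := boolP (le x0 x).
    have x0y := le_trans x0x xy.
    by rewrite /F x0y x0x psi_st //; split=> //; apply: Jup.
  by rewrite Flow // /F (negPf x0x).
have V_out x y : J x -> ~~ J y -> le x y -> f x y (V x) = 0.
  move=> Jx; rewrite {1}/J negb_and !implybE !negb_or !negbK.
  move=> /orP [] /andP [] + d xy.
    move=> yx0; have := late_mono _ _ xy yx0 (Jlow _ Jx (le_trans xy yx0)).
    by rewrite /born_late d.
  move=> x0y; rewrite Vup //; apply/eqP; rewrite -memv_ker.
  by have := v_ker _ x0y; rewrite d.
have F_out x y : ~~ J x -> J y -> le x y -> (F y \o f x y)%VF = 0.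
  rewrite {1}/J negb_and !implybE !negb_or !negbK => /orP [] /andP [] + d Jy xy.
    move=> xx0; rewrite Flow //; apply/lfunP => u.
    rewrite comp_lfunE zero_lfunE; apply/eqP; rewrite -memv_ker.
    have := v_img _ xx0; rewrite /born_late d => /subvP; apply.
    by rewrite memv_img ?memvf.
  move=> x0x; have := died_mono _ _ x0x xy d.
  by rewrite (negPf (Jup _ Jy (le_trans x0x xy))).
have Jx0 : J x0 by rewrite /J late_x0 died_x0 !implybT.
have FV x : J x -> F x (V x) = 1.
  move=> Jx; have /orP [xx0|x0x] := le_total x x0.
    rewrite -(FF x x0) // comp_lfunE Vx0 //.
    by have := Fx0 x0 Jx0 (le_refl _); rewrite pm_id comp_lfun1r => ->.
  rewrite -(VV x0 x) // -comp_lfunE Fx0 //.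
  by have := Vx0 x0 Jx0 (le_refl _); rewrite pm_id id_lfunE => ->.
pose h x := if J x then rank_one (F x) (V x) else 0.
have hJ x : h x != 0 -> J x by rewrite /h; case: (J x); rewrite ?eqxx.
exists h; split.
- move=> x y xy; apply/lfunP => u; rewrite !comp_lfunE /h.
  case: (boolP (J x)) => Jx; case: (boolP (J y)) => Jy.
  + by rewrite !rank_oneE linearZ /= VV // -comp_lfunE FF.
  + by rewrite zero_lfunE rank_oneE linearZ /= V_out // scaler0.
  + rewrite zero_lfunE linear0 rank_oneE -comp_lfunE F_out //.
    by rewrite zero_lfunE scale0r.
  + by rewrite !zero_lfunE linear0.
- move=> x; rewrite /h; case: ifP => Jx; last by rewrite comp_lfun0l.
  apply/lfunP => u; rewrite comp_lfunE !rank_oneE linearZ /= FV //.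
  by congr (_ *: _); apply: mulr1.
- split; rewrite /h ?Jx0.
  + by rewrite /J bot_le (negPf late_bot).
  + by rewrite /J le_top died_top andbF.
  + apply/lfunPn; exists (V x0); rewrite zero_lfunE rank_oneE FV // scale1r.
    by have := Vx0 x0 Jx0 (le_refl _); rewrite pm_id id_lfunE => ->.
- move=> x; rewrite /h; case: ifP => Jx; last by rewrite lim0g dimv0.
  apply: leq_trans (dimvS (limg_rank_one _ _)) _.
  by rewrite dim_vline; case: eqP.
- move=> x y xy hx hy; have Jx := hJ _ hx; have Jy := hJ _ hy.
  apply/eqP; rewrite -subv0; apply/subvP => u; rewrite memv_cap memv_ker /h Jx.
  move=> /andP [/(subvP (limg_rank_one _ _)) /vlineP [a ->]].
  rewrite linearZ /= VV // scaler_eq0 => /orP [/eqP ->|/eqP V0].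
    by rewrite scale0r mem0v.
  have := FV y Jy; rewrite V0 linear0 => /eqP.
  by rewrite eq_sym oner_eq0.
Qed.

End IntervalSummand.

(** * Counting intervals along finite chains *)

Section IntervalCount.
Variables (k : fieldType) (I : Type) (le : rel I).
Implicit Types E F G : pmod k le.

(* On a finite chain [x :: s] this is the number of intervals in the
   decomposition of [E], each being counted at its last element. *)
Fixpoint cnt E x (s : seq I) : nat :=
  if s is y :: s' then (\dim (lker (pm_map E x y)) + cnt E y s')%N
  else \dim {:E x}.

(* the same intervals, but for those through [x], counted at their births *)
Fixpoint births E x (s : seq I) : nat :=
  if s is y :: s' then (\dim (limg (pm_map E x y))^C + births E y s')%N
  else 0%N.

(** Rank-nullity at each step. Kernels behave well under subobjects and cokernels under quotients;
    this identity gives the count both properties. *)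
Lemma cnt_births E x s : cnt E x s = (\dim {:E x} + births E x s)%N.
Proof.
elim: s x => [|y s IH] x /=; first by rewrite addn0.
rewrite IH dimv_compl -(limg_ker_dim (pm_map E x y) fullv) capfv.
rewrite -!addnA; congr (_ + _)%N; rewrite !addnA; congr (_ + _)%N.
by rewrite subnKC // dimvS ?subvf.
Qed.

Lemma cnt_ge_head E x s : (\dim {:E x} <= cnt E x s)%N.
Proof. by rewrite cnt_births leq_addr. Qed.

Definition pm_hom E F (g : forall i, 'Hom(E i, F i)) : Prop :=
  forall i j u, le i j -> g j (pm_map E i j u) = pm_map F i j (g i u).

Lemma cnt_sub E F (g : forall i, 'Hom(E i, F i)) x s :
  pm_hom g -> (forall i, lker (g i) = 0%VS) -> path le x s ->
  (cnt E x s <= cnt F x s)%N.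
Proof.
move=> g_hom g_inj.
have dim_g i U : \dim (g i @: U) = \dim U by rewrite limg_dim_eq // g_inj capv0.
elim: s x => [|y s IH] x /=; first by rewrite -dim_g dimvS ?subvf.
case/andP=> xy /IH; apply: leq_add.
rewrite -dim_g; apply/dimvS/subvP => _ /memv_imgP [u + ->].
by rewrite !memv_ker -g_hom // => /eqP ->; rewrite linear0.
Qed.

(** Counted at births, by right exactness: if the images of the [E j] generate [F y], then those of
    complements of the incoming images generate it modulo the image of [F x]. One statement covers
    quotients ([n = 1]) and finite sums. *)
Lemma cnt_gen n (E : 'I_n -> pmod k le) F
    (g : forall j i, 'Hom(E j i, F i)) x s :
  (forall j, pm_hom (g j)) ->
  (forall i, (fullv <= \sum_j limg (g j i))%VS) -> path le x s ->
  (cnt F x s <= \sum_j cnt (E j) x s)%N.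
Proof.
move=> g_hom g_gen.
under [leqRHS]eq_bigr do rewrite cnt_births.
have dim_g (U : forall j i, {vspace E j i}) i :
    (\dim (\sum_j g j i @: U j i)%VS <= \sum_j \dim (U j i))%N.
  apply: leq_trans (dimv_leq_sum _ _ _) _; apply: leq_sum => j _.
  by rewrite -[leqRHS](limg_ker_dim (g j i)) leq_addl.
rewrite big_split cnt_births /= => xs; apply: leq_add.
  exact: leq_trans (dimvS (g_gen x)) (dim_g (fun _ _ => fullv) x).
elim: s x xs => [|y s IH] x /=; first by rewrite big1.
case/andP=> xy /IH {}IH; rewrite big_split /=; apply: leq_add => //.
pose C j i := ((limg (pm_map (E j) x i))^C)%VS.
apply: leq_trans (dim_g C y); rewrite dimv_compl leq_subLR.
apply: leq_trans (dimv_add_leqif _ _); apply/dimvS/(subv_trans (g_gen y)).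
apply/subv_sumP => j _.
rewrite -(addv_complf (limg (pm_map (E j) x y))) limgD; apply: addvS.
  apply/subvP => _ /memv_imgP [_ /memv_imgP [u _ ->] ->].
  by rewrite g_hom // memv_img ?memvf.
exact: (sumv_sup j).
Qed.

Lemma cnt_quot E F (g : forall i, 'Hom(E i, F i)) x s :
  pm_hom g -> (forall i, limg (g i) = fullv) -> path le x s ->
  (cnt F x s <= cnt E x s)%N.
Proof.
move=> g_hom g_onto xs.
have := @cnt_gen 1 (fun _ => E) F (fun _ => g) x s (fun _ => g_hom) _ xs.
by rewrite big_ord1; apply=> i; rewrite big_ord1 g_onto.
Qed.

(** Left exactness of kernels: an element of the kernel of [F x -> F y] maps into the kernel for
    [G], and if it comes from [E] it comes from the kernel for [E]. *)
Lemma cnt_ext E F G (g : forall i, 'Hom(E i, F i))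
    (h : forall i, 'Hom(F i, G i)) x s :
  pm_hom g -> pm_hom h -> (forall i, lker (g i) = 0%VS) ->
  (forall i, (lker (h i) <= limg (g i))%VS) -> path le x s ->
  (cnt F x s <= cnt E x s + cnt G x s)%N.
Proof.
move=> g_hom h_hom g_inj gh.
have dim_g i U : \dim (g i @: U) = \dim U by rewrite limg_dim_eq // g_inj capv0.
have step x0 U V W : (U :&: lker (h x0) <= g x0 @: V)%VS ->
    (h x0 @: U <= W)%VS -> (\dim U <= \dim V + \dim W)%N.
  move=> UV UW; rewrite -(limg_ker_dim (h x0)); apply: leq_add.
    by rewrite -(dim_g x0 V) dimvS.
  exact: dimvS.
elim: s x => [|y s IH] x /=.
  by move=> _; apply: (step x); rewrite ?capfv ?gh ?subvf.
case/andP=> xy /IH {}IH; rewrite addnACA; apply: leq_add => //.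
apply: (step x).
  apply/subvP => u /memv_capP [uk /(subvP (gh x)) /memv_imgP [e _ ue]].
  rewrite ue memv_img // memv_ker; move: uk.
  rewrite ue memv_ker -g_hom // -memv_ker g_inj memv0 => /eqP ->.
  by rewrite eqxx.
apply/subvP => _ /memv_imgP [u + ->].
by rewrite !memv_ker -h_hom // => /eqP ->; rewrite linear0.
Qed.

Lemma cnt_add E F G (g : forall i, 'Hom(E i, F i))
    (h : forall i, 'Hom(G i, F i)) x s :
  pm_hom g -> pm_hom h ->
  (forall i, lker (g i) = 0%VS) -> (forall i, lker (h i) = 0%VS) ->
  (forall i, limg (g i) :&: limg (h i) = 0)%VS -> path le x s ->
  (cnt E x s + cnt G x s <= cnt F x s)%N.
Proof.
move=> g_hom h_hom g_inj h_inj gh.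
have step x0 U V W : (g x0 @: U <= W)%VS -> (h x0 @: V <= W)%VS ->
    (\dim U + \dim V <= \dim W)%N.
  move=> UW VW.
  rewrite -(limg_dim_eq (f := g x0) (U := U)) ?g_inj ?capv0 //.
  rewrite -(limg_dim_eq (f := h x0) (U := V)) ?h_inj ?capv0 //.
  rewrite -dimv_disjoint_sum; first by rewrite dimvS // subv_add UW.
  by apply/eqP; rewrite -subv0 -(gh x0) capvS // limgS // subvf.
elim: s x => [|y s IH] x /=; first by move=> _; apply: (step x); rewrite subvf.
case/andP=> xy /IH {}IH; rewrite addnACA; apply: leq_add => //.
by apply: (step x); apply/subvP => _ /memv_imgP [u + ->];
  rewrite !memv_ker -?g_hom -?h_hom // => /eqP ->; rewrite linear0.
Qed.

Section Total.
Hypotheses (le_trans : transitive le) (le_total : total le).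

(** Refining a chain cannot lower the count, since the kernel of a composite is at most as large as
    the two kernels together. The refined chain is chosen before [E], so the same one serves both
    summands of a direct sum. *)
Lemma cnt_insert z x s : path le x s -> exists x' s',
  [/\ path le x' s', forall E, (cnt E x s <= cnt E x' s')%N
    & forall E, (\dim {:E z} <= cnt E x' s')%N].
Proof.
have nle i j : ~~ le i j -> le j i by have := le_total i j; case: (le i j).
have dim_ker E i l j : le i l -> le l j ->
  (\dim (lker (pm_map E i j)) <=
    \dim (lker (pm_map E i l)) + \dim (lker (pm_map E l j)))%N.
  move=> il lj; rewrite -(limg_ker_dim (pm_map E i l)).
  apply: leq_add; first by rewrite dimvS ?capvSr.
  apply/dimvS/subvP => _ /memv_imgP [u + ->].
  by rewrite !memv_ker -comp_lfunE pm_comp.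
move=> xs; have [zx|/nle xz] := boolP (le z x).
  exists z, (x :: s); split; first by rewrite /= zx.
    by move=> E /=; apply: leq_addl.
  by move=> E; apply: cnt_ge_head.
exists x; elim: s x xs xz => [|y s IH] x /=.
  move=> _ xz; exists [:: z]; split; first by rewrite /= xz.
    by move=> E; apply: cnt_ge_head.
  by move=> E /=; apply: leq_addl.
case/andP=> xy ys xz; have [zy|/nle yz] := boolP (le z y).
  exists (z :: y :: s); split; first by rewrite /= xz zy.
    by move=> E /=; rewrite addnA leq_add2r dim_ker.
  move=> E /=; apply: leq_trans (leq_addl _ _).
  exact: (cnt_ge_head E z (y :: s)).
have [s' [ys' le_s' z_s']] := IH y ys yz.
exists (y :: s'); split; first by rewrite /= xy.
  by move=> E /=; rewrite leq_add2l.
by move=> E /=; apply: leq_trans (z_s' E) (leq_addl _ _).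
Qed.

(** A step contributes only when it goes from a nonzero space to a zero one. After that everything
    is zero, for a map to a later nonzero space would be injective and yet factor through zero. *)
Lemma cnt_thin E x s :
  (forall i, (\dim {:E i} <= 1)%N) ->
  (forall i j, le i j -> \dim {:E i} <> 0%N -> \dim {:E j} <> 0%N ->
    lker (pm_map E i j) = 0%VS) ->
  path le x s -> (cnt E x s <= 1)%N.
Proof.
move=> thin inj.
have dead i j : le i j -> \dim {:E i} = 0%N -> lker (pm_map E i j) = 0%VS.
  move=> _ Ei; apply/eqP; rewrite -dimv_eq0 -leqn0 -Ei.
  exact/dimvS/subvf.
elim: s x => [|y s IH] x /=; first by [].
case/andP=> xy ys; have [/(dead _ _ xy) ->|/eqP Ex] := eqVneq (\dim {:E x}) 0%N.
  by rewrite dimv0 IH.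
have [Ey|/eqP Ey] := eqVneq (\dim {:E y}) 0%N; last first.
  by rewrite inj // dimv0 IH.
have Exy u : pm_map E x y u = 0 by apply: (dimvf_eq0P _).1.
have dead_after z : le y z -> \dim {:E z} = 0%N.
  move=> yz; have [//|/eqP Ez] := eqVneq (\dim {:E z}) 0%N.
  case: (Ex); apply/eqP.
  rewrite dimv_eq0 -subv0 -(inj _ _ (le_trans xy yz)) //.
  apply/subvP => u _.
  by rewrite memv_ker -(pm_comp E xy yz) comp_lfunE Exy linear0.
suff -> : cnt E y s = 0%N.
  by rewrite addn0; apply: leq_trans (dimvS (subvf _)) (thin x).
have refl i : le i i by have := le_total i i; case: (le i i).
elim: s (y) ys dead_after {IH xy Ex Ey Exy} => [|z s IH] i /=.
  by move=> _ ->.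
case/andP=> iz zs dead_i.
rewrite IH //; last by move=> j zj; apply/dead_i/(le_trans iz).
rewrite addn0; apply/eqP; rewrite -leqn0 -(dead_i i) //.
exact/dimvS/subvf.
Qed.

(** Every interval reaches [bot] or [top]. The induction bounds the count from [x] on by the
    dimension of the image of [bot] in [E x] plus that of [E top]: a kernel on the way lies in the
    image of [bot], so each death is paid for by a drop of that dimension. *)
Lemma cnt_reduced E bot top x s :
  (forall i, le bot i) -> (forall i, le i top) ->
  (forall i, (lker (pm_map E i top) <= limg (pm_map E bot i))%VS) ->
  path le x s -> (cnt E x s <= \dim {:E bot} + \dim {:E top})%N.
Proof.
move=> bot_le le_top red xs.
apply: leq_trans (_ : (\dim (limg (pm_map E bot x)) + \dim {:E top} <= _)%N);
  last first.
  by rewrite leq_add2r -[leqRHS](limg_ker_dim (pm_map E bot x)) leq_addl.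
elim: s x xs => [|y s IH] x /=.
  move=> _; rewrite -(limg_ker_dim (pm_map E x top)) capfv.
  by rewrite leq_add // dimvS // subvf.
case/andP=> xy /IH {}IH.
have ker_img : (lker (pm_map E x y) <= limg (pm_map E bot x))%VS.
  apply: subv_trans (red x); apply/subvP => u; rewrite !memv_ker => /eqP u0.
  by rewrite -(pm_comp E xy (le_top y)) comp_lfunE u0 linear0.
rewrite -(limg_ker_dim (pm_map E x y) (limg (pm_map E bot x))) -addnA.
rewrite (capv_idPr ker_img) leq_add2l; apply: leq_trans IH _.
by rewrite -limg_comp pm_comp.
Qed.

End Total.

End IntervalCount.

(** * Pointwise kernels, quotients, sums and idempotents of representations *)

Section Representations.
Variables (k : fieldType) (Q : thread_quiver).
Local Notation C := (rep_pwf k Q).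
Implicit Types (M N W : rep k Q) (x y z : obj Q).

(** [fmor] at concrete types, so that it can be declared linear and applied to vectors; [nat_at]
    does the same for components of natural maps. *)
Definition rmap M x y (f : path_hom k x y) : 'Hom(M x, M y) := fmor M f.

Lemma rmap_linear M x y : linear (@rmap M x y).
Proof. by move=> a f g; apply: (lf_linear M a f g). Qed.

HB.instance Definition _ M x y :=
  GRing.isLinear.Build k (path_hom k x y) 'Hom(M x, M y) _ (@rmap M x y)
    (@rmap_linear M x y).

Lemma rmap_id M x v : rmap M << plid x >> v = v.
Proof. by rewrite /rmap (lf_id M x) /= id_lfunE. Qed.

Lemma rmap_comp M x y z (g : path_hom k y z) (f : path_hom k x y) v :
  rmap M (path_comp g f) v = rmap M g (rmap M f v).
Proof. by rewrite /rmap (lf_comp M g f) /= comp_lfunE. Qed.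

Lemma rmapU M x y z (q : pathlike y z) (p : pathlike x y) v :
  rmap M << plcomp q p >> v = rmap M << q >> (rmap M << p >> v).
Proof. by rewrite -path_compU rmap_comp. Qed.

Lemma rmapE M x y (f : path_hom k x y) :
  rmap M f = \sum_(p <- msupp f) f@_p *: rmap M << p >>.
Proof.
rewrite -{1}[f]mlift_id /mlift linear_sum; apply: eq_bigr => p _.
by rewrite linearZ.
Qed.

Definition nat_at M N (u : hom C M N) x : 'Hom(M x, N x) := ncomp u x.

Lemma nat_atN M N (u : hom C M N) x y (f : path_hom k x y) v :
  nat_at u y (rmap M f v) = rmap N f (nat_at u x v).
Proof.
have /(congr1 (fun g : 'Hom(M x, N y) => g v)) := nt_natural u f.
by rewrite /= !comp_lfunE.
Qed.

Lemma nat_ext M N (u w : hom C M N) :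
  (forall x v, nat_at u x v = nat_at w x v) -> u = w.
Proof. by move=> uw; apply: nattransP => x; apply/lfunP => v; apply: uw. Qed.

Lemma nat_at_comp M N W (w : hom C N W) (u : hom C M N) x v :
  nat_at (comp C w u) x v = nat_at w x (nat_at u x v).
Proof. exact: comp_lfunE. Qed.

Lemma nat_at_id M x v : nat_at (idm C M) x v = v.
Proof. exact: id_lfunE. Qed.

Lemma nat_at0 M N x : nat_at (0 : hom C M N) x = 0.
Proof. by []. Qed.

Lemma nat_atD M N (u w : hom C M N) x :
  nat_at (u + w) x = nat_at u x + nat_at w x.
Proof. by []. Qed.

Lemma nat_atNeg M N (u : hom C M N) x : nat_at (- u) x = - nat_at u x.
Proof. by []. Qed.

Lemma mk_nat M N (u : forall x, 'Hom(M x, N x)) :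
  (forall x y (p : pathlike x y) v,
    u y (rmap M << p >> v) = rmap N << p >> (u x v)) ->
  exists w : hom C M N, forall x, nat_at w x = u x.
Proof.
move=> u_nat.
have nat_u x y (f : path_hom k x y) : (u y \o rmap M f = rmap N f \o u x)%VF.
  apply/lfunP => v.
  rewrite !comp_lfunE (rmapE M) (rmapE N) !sum_lfunE linear_sum.
  by apply: eq_bigr => p _; rewrite !scale_lfunE linearZ /= u_nat.
by exists (@Nattrans _ _ _ _ (fdvect k) M N u nat_u).
Qed.

Section Retract.
Variables (M : rep k Q) (E : obj Q -> vectType k).
Variables (i : forall x, 'Hom(E x, M x)) (p : forall x, 'Hom(M x, E x)).
Hypothesis pi : forall x v, p x (i x v) = v.
Hypothesis pi_map : forall x y z (g : path_hom k y z) (f : path_hom k x y) v,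
    p z (rmap M g (i y (p y (rmap M f (i x v))))) =
    p z (rmap M g (rmap M f (i x v))).

(** [pi_map] is functoriality of [p \o M f \o i]. It holds when the images of [i] are stable and
    also when the kernels of [p] are, so subobjects and quotients are both built this way. *)
Program Definition retract_rep : rep k Q :=
  @Linfunctor k (obj Q) (vectType k) (path_cat k Q) (fdvect k) E
    (fun x y f => (p y \o rmap M f \o i x)%VF) _ _ _.
Next Obligation.
by rewrite linearP comp_lfunDr comp_lfunDl -comp_lfunZr -comp_lfunZl.
Qed.
Next Obligation.
by apply/lfunP => v; rewrite !comp_lfunE rmap_id pi id_lfunE.
Qed.
Next Obligation.
by apply/lfunP => v; rewrite !comp_lfunE rmap_comp pi_map.
Qed.

Lemma retract_rmap x y (f : path_hom k x y) v :
  rmap retract_rep f v = p y (rmap M f (i x v)).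
Proof. by rewrite /rmap /= !comp_lfunE. Qed.

End Retract.

Definition stable M (S : forall x, {vspace M x}) : Prop :=
  forall x y (p : pathlike x y) v, v \in S x -> rmap M << p >> v \in S y.

Lemma stable_rmap M S x y (f : path_hom k x y) v :
  @stable M S -> v \in S x -> rmap M f v \in S y.
Proof.
move=> S_st vS; rewrite rmapE sum_lfunE; apply: rpred_sum => p _.
by rewrite scale_lfunE memvZ ?S_st.
Qed.

Lemma ex_subrep M S : @stable M S -> exists N (i : hom C N M),
  forall x, lker (nat_at i x) = 0%VS /\ limg (nat_at i x) = S x.
Proof.
move=> S_st; pose E x : vectType k := subvs_of (S x).
pose i x : 'Hom(E x, M x) := linfun vsval.
pose p x : 'Hom(M x, E x) := linfun (vsproj (S x)).
have iE x v : i x v = vsval v by rewrite lfunE.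
have pE x v : p x v = vsproj (S x) v by rewrite lfunE.
have pi x v : p x (i x v) = v by rewrite pE iE vsvalK.
have ip x v : v \in S x -> i x (p x v) = v by move=> vS; rewrite pE iE vsprojK.
have iS x v : i x v \in S x by rewrite iE subvsP.
have pi_map x y z (g : path_hom k y z) (f : path_hom k x y) v :
    p z (rmap M g (i y (p y (rmap M f (i x v))))) =
    p z (rmap M g (rmap M f (i x v))).
  by rewrite ip ?(stable_rmap _ S_st) ?iS.
pose N := retract_rep pi pi_map.
have [|j jE] := @mk_nat N M i.
  by move=> x y q v; rewrite retract_rmap ip ?S_st ?iS.
exists N, j => x; rewrite jE; split.
  by apply/eqP/lker0P; apply: (can_inj (pi x)).
apply/vspaceP => v; apply/memv_imgP/idP => [[u _ ->]|vS]; first exact: iS.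
by exists (p x v); rewrite ?memvf ?ip.
Qed.

Lemma ex_quotrep M S : @stable M S -> exists N (q : hom C M N),
  forall x, limg (nat_at q x) = fullv /\ lker (nat_at q x) = S x.
Proof.
(* The quotient lives on the complement of [S x], with the projection along [S x] as quotient
   map. *)
move=> S_st; pose E x : vectType k := subvs_of ((S x)^C)%VS.
pose i x : 'Hom(E x, M x) := linfun vsval.
pose p x : 'Hom(M x, E x) := (linfun (vsproj ((S x)^C)%VS) \o quov (S x))%VF.
have iE x v : i x v = vsval v by rewrite lfunE.
have ip x v : i x (p x v) = quov (S x) v.
  by rewrite comp_lfunE iE lfunE /= vsprojK // memv_pi.
have pi x v : p x (i x v) = v.
  rewrite comp_lfunE lfunE /= iE /quov daddv_pi_id ?subvsP ?vsvalK //.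
  by rewrite capvC capv_compl.
have p0 x v : (p x v == 0) = (v \in S x).
  rewrite -quov_eq0 -ip; apply/eqP/eqP => [->|ip0]; first by rewrite linear0.
  by rewrite -[LHS]pi ip0 linear0.
have p_sub x v : v - i x (p x v) \in S x by rewrite ip quov_sub.
have p_map x y (f : path_hom k x y) v :
    p y (rmap M f (i x (p x v))) = p y (rmap M f v).
  apply/eqP; rewrite eq_sym -subr_eq0 -!linearB /= p0.
  exact/(stable_rmap _ S_st)/p_sub.
have pi_map x y z (g : path_hom k y z) (f : path_hom k x y) v :
    p z (rmap M g (i y (p y (rmap M f (i x v))))) =
    p z (rmap M g (rmap M f (i x v))).
  exact: p_map.
pose N := retract_rep pi pi_map.
have [|q qE] := @mk_nat M N p.
  by move=> x y g v; rewrite retract_rmap p_map.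
exists N, q => x; rewrite qE; split.
  apply/vspaceP => v; rewrite memvf; apply/memv_imgP.
  by exists (i x v); rewrite ?memvf ?pi.
by apply/vspaceP => v; rewrite memv_ker p0.
Qed.

Lemma ex_factor_mono M N W (i : hom C N M) (h : hom C W M) :
  (forall x, lker (nat_at i x) = 0%VS) ->
  (forall x, (limg (nat_at h x) <= limg (nat_at i x))%VS) ->
  exists u, comp C i u = h.
Proof.
move=> i_inj hi.
have inj x : injective (nat_at i x) by apply/lker0P; rewrite i_inj.
pose u x := ((nat_at i x)^-1 \o nat_at h x)%VF.
have iu x v : nat_at i x (u x v) = nat_at h x v.
  by rewrite comp_lfunE limg_lfunVK // (subvP (hi x)) ?memv_img ?memvf.
have [|w wE] := @mk_nat W N u.
  by move=> x y p v; apply: inj; rewrite iu !nat_atN iu.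
by exists w; apply: nat_ext => x v; rewrite nat_at_comp wE iu.
Qed.

Lemma ex_factor_epi M N W (q : hom C M N) (h : hom C M W) :
  (forall x, limg (nat_at q x) = fullv) ->
  (forall x, (lker (nat_at q x) <= lker (nat_at h x))%VS) ->
  exists u, comp C u q = h.
Proof.
move=> q_onto qh.
pose u x := (nat_at h x \o (nat_at q x)^-1)%VF.
have uq x v : u x (nat_at q x v) = nat_at h x v.
  apply/eqP; rewrite comp_lfunE -subr_eq0 -linearB -memv_ker.
  apply: (subvP (qh x)); rewrite memv_ker linearB /= limg_lfunVK ?subrr //.
  by rewrite memv_img ?memvf.
have [|w wE] := @mk_nat N W u.
  move=> x y p v; have : v \in limg (nat_at q x) by rewrite q_onto memvf.
  by case/memv_imgP => v' _ ->; rewrite -nat_atN !uq nat_atN.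
by exists w; apply: nat_ext => x v; rewrite nat_at_comp wE uq.
Qed.

Lemma mono_at M N W (i : hom C N M) (u w : hom C W N) :
  (forall x, lker (nat_at i x) = 0%VS) -> comp C i u = comp C i w -> u = w.
Proof.
move=> i_inj iuw; apply: nat_ext => x v.
have inj : injective (nat_at i x) by apply/lker0P; rewrite i_inj.
by apply: inj; rewrite -!nat_at_comp iuw.
Qed.

Lemma epi_at M N W (q : hom C M N) (u w : hom C N W) :
  (forall x, limg (nat_at q x) = fullv) -> comp C u q = comp C w q -> u = w.
Proof.
move=> q_onto uwq; apply: nat_ext => x v.
have : v \in limg (nat_at q x) by rewrite q_onto memvf.
by case/memv_imgP => v' _ ->; rewrite -!nat_at_comp uwq.
Qed.

Lemma comp0_at M N W (f : hom C M N) (g : hom C N W) :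
  comp C g f = 0 <-> forall x, (limg (nat_at f x) <= lker (nat_at g x))%VS.
Proof.
split=> [gf x|gf].
  apply/subvP => _ /memv_imgP [v _ ->].
  by rewrite memv_ker -nat_at_comp gf nat_at0 zero_lfunE.
apply: nat_ext => x v; rewrite nat_at_comp nat_at0 zero_lfunE.
by apply/eqP; rewrite -memv_ker (subvP (gf x)) ?memv_img ?memvf.
Qed.

Lemma is_kernel_at M N W (f : hom C M N) (g : hom C N W) :
  (forall x, lker (nat_at f x) = 0%VS) ->
  (forall x, limg (nat_at f x) = lker (nat_at g x)) -> is_kernel g f.
Proof.
move=> f_inj fg; split=> [|V h /comp0_at hg].
  by apply/comp0_at => x; rewrite fg.
have [|u fu] := ex_factor_mono (h := h) f_inj; first by move=> x; rewrite fg.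
by exists u; split=> // u' fu'; apply: (mono_at f_inj); rewrite fu.
Qed.

Lemma is_cokernel_at M N W (f : hom C M N) (g : hom C N W) :
  (forall x, limg (nat_at g x) = fullv) ->
  (forall x, limg (nat_at f x) = lker (nat_at g x)) -> is_cokernel f g.
Proof.
move=> g_onto fg; split=> [|V h /comp0_at hg].
  by apply/comp0_at => x; rewrite fg.
have [|u ug] := ex_factor_epi (h := h) g_onto; first by move=> x; rewrite -fg.
by exists u; split=> // u' ug'; apply: (epi_at g_onto); rewrite ug.
Qed.

Lemma stable_ker M N (u : hom C M N) : stable (fun x => lker (nat_at u x)).
Proof.
by move=> x y p v; rewrite !memv_ker nat_atN => /eqP ->; rewrite linear0.
Qed.

Lemma stable_img M N (u : hom C M N) : stable (fun x => limg (nat_at u x)).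
Proof.
move=> x y p _ /memv_imgP [v _ ->].
by rewrite -nat_atN memv_img ?memvf.
Qed.

Lemma is_zeroP M : is_zero C M <-> forall x, \dim {:M x} = 0%N.
Proof.
split=> [M0 x|M0 N].
  have [/(_ (idm C M)) id0 _] := M0 M.
  by apply/dimvf_eq0P => v; rewrite -[v]nat_at_id id0 nat_at0 zero_lfunE.
have z x (v : M x) : v = 0 by apply: (dimvf_eq0P _).1.
split=> f; apply: nat_ext => x v; first by rewrite [v]z !linear0.
by rewrite [LHS]z [RHS]z.
Qed.

Program Definition zero_rep : rep k Q :=
  @Linfunctor k (obj Q) (vectType k) (path_cat k Q) (fdvect k)
    (fun=> 'rV[k]_0) (fun _ _ _ => 0) _ _ _.
Next Obligation. by rewrite scaler0 addr0. Qed.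
Next Obligation.
by apply/lfunP => v; apply/rowP => -[].
Qed.
Next Obligation. by rewrite comp_lfun0l. Qed.

Lemma zero_rep_zero : is_zero C zero_rep.
Proof.
by apply/is_zeroP => x; apply/dimvf_eq0P => v; apply/rowP => -[].
Qed.

Section SumRep.
Variables M N : rep k Q.

Definition pair_map x y (f : path_hom k x y) (v : M x * N x) : M y * N y :=
  (rmap M f v.1, rmap N f v.2).

Lemma pair_map_linear x y (f : path_hom k x y) : linear (pair_map f).
Proof. by move=> a u v; rewrite /pair_map /= !linearP. Qed.

HB.instance Definition _ x y (f : path_hom k x y) :=
  GRing.isLinear.Build k (M x * N x)%type (M y * N y)%type _ (pair_map f)
    (pair_map_linear f).

Program Definition sum_rep : rep k Q :=
  @Linfunctor k (obj Q) (vectType k) (path_cat k Q) (fdvect k)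
    (fun x => (M x * N x)%type) (fun x y f => linfun (pair_map f)) _ _ _.
Next Obligation.
apply/lfunP => v; rewrite add_lfunE scale_lfunE !lfunE /= /pair_map.
by rewrite !linearP !add_lfunE !scale_lfunE.
Qed.
Next Obligation.
by apply/lfunP => -[u v]; rewrite !lfunE /= /pair_map !rmap_id.
Qed.
Next Obligation.
by apply/lfunP => v; rewrite !comp_lfunE !lfunE /= /pair_map !rmap_comp.
Qed.

Lemma sum_rmap x y (f : path_hom k x y) v : rmap sum_rep f v = pair_map f v.
Proof. by rewrite /rmap /= lfunE. Qed.

Definition pair_inl x (u : M x) : M x * N x := (u, 0).
Definition pair_inr x (v : N x) : M x * N x := (0, v).

Lemma pair_inl_linear x : linear (@pair_inl x).
Proof. by move=> a u v; rewrite /pair_inl -[RHS]/(_, _) /= scaler0 addr0. Qed.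
Lemma pair_inr_linear x : linear (@pair_inr x).
Proof. by move=> a u v; rewrite /pair_inr -[RHS]/(_, _) /= scaler0 addr0. Qed.

HB.instance Definition _ x :=
  GRing.isLinear.Build k (M x) (M x * N x)%type _ (@pair_inl x)
    (@pair_inl_linear x).
HB.instance Definition _ x :=
  GRing.isLinear.Build k (N x) (M x * N x)%type _ (@pair_inr x)
    (@pair_inr_linear x).

Lemma direct_sum_rep : direct_sum C M N sum_rep.
Proof.
have [|i1 i1E] := @mk_nat M sum_rep (fun x => linfun (@pair_inl x)).
  by move=> x y p v; rewrite sum_rmap !lfunE /= /pair_map /= linear0.
have [|i2 i2E] := @mk_nat N sum_rep (fun x => linfun (@pair_inr x)).
  by move=> x y p v; rewrite sum_rmap !lfunE /= /pair_map /= linear0.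
have [|p1 p1E] := @mk_nat sum_rep M (fun x => linfun (fst : M x * N x -> M x)).
  by move=> x y p v; rewrite sum_rmap !lfunE.
have [|p2 p2E] := @mk_nat sum_rep N (fun x => linfun (snd : M x * N x -> N x)).
  by move=> x y p v; rewrite sum_rmap !lfunE.
exists i1, i2, p1, p2; split; apply: nat_ext => x v.
- by rewrite nat_at_comp nat_at_id p1E i1E !lfunE.
- by rewrite nat_at_comp nat_at_id p2E i2E !lfunE.
- by rewrite nat_at_comp nat_at0 p2E i1E !lfunE.
- by rewrite nat_at_comp nat_at0 p1E i2E !lfunE.
rewrite nat_atD add_lfunE !nat_at_comp nat_at_id p1E i1E p2E i2E !lfunE /=.
by case: v => u v; rewrite -[LHS]/(_, _) /= addr0 add0r.
Qed.

End SumRep.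

Lemma split_idem M (e : hom C M M) : comp C e e = e ->
  exists N (i : hom C N M) (p : hom C M N),
    comp C p i = idm C N /\ comp C i p = e.
Proof.
move=> ee; have [N [i iP]] := ex_subrep (@stable_img _ _ e).
have i_inj x : lker (nat_at i x) = 0%VS by have [] := iP x.
have i_img x : limg (nat_at i x) = limg (nat_at e x) by have [] := iP x.
have [|p ip] := ex_factor_mono (h := e) i_inj; first by move=> x; rewrite i_img.
exists N, i, p; split=> //; apply: (mono_at i_inj).
rewrite lc_compA ip lc_compm1; apply: nat_ext => x v; rewrite nat_at_comp.
have : nat_at i x v \in limg (nat_at e x) by rewrite -i_img memv_img ?memvf.
by case/memv_imgP => u _ ->; rewrite -nat_at_comp ee.
Qed.

Lemma split_idem_sum M (e : hom C M M) : comp C e e = e ->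
  exists N N' (i : hom C N M) (i' : hom C N' M)
    (p : hom C M N) (p' : hom C M N'),
    is_biproduct i i' p p' /\ comp C i' p' = e.
Proof.
move=> ee; have [N' [i' [p' [pi' ip']]]] := split_idem ee.
pose e1 := idm C M - e.
have e1e : comp C e1 e = 0.
  by rewrite /e1 lc_compDl -scaleN1r lc_compZl lc_comp1m ee scaleN1r subrr.
have ee1 : comp C e e1 = 0.
  by rewrite /e1 lc_compDr -scaleN1r lc_compZr lc_compm1 ee scaleN1r subrr.
have e1e1 : comp C e1 e1 = e1.
  by rewrite {1}/e1 lc_compDl -scaleN1r lc_compZl lc_comp1m ee1 scaler0 addr0.
have [N [i [p [pi ip]]]] := split_idem e1e1.
exists N, N', i, i', p, p'; split=> //; split=> //.
- rewrite -[p']lc_comp1m -[i]lc_compm1 -pi' -pi.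
  by rewrite -!lc_compA [comp C i' (comp C _ _)]lc_compA ip'
    [comp C i (comp C p i)]lc_compA ip [comp C e _]lc_compA ee1
    lc_comp0l lc_comp0r.
- rewrite -[p]lc_comp1m -[i']lc_compm1 -pi' -pi.
  by rewrite -!lc_compA [comp C i (comp C _ _)]lc_compA ip
    [comp C i' (comp C p' i')]lc_compA ip' [comp C e1 _]lc_compA e1e
    lc_comp0l lc_comp0r.
- by rewrite ip ip' subrK.
Qed.

Lemma biproduct_at M N S (i1 : hom C M S) (i2 : hom C N S) (p1 : hom C S M)
    (p2 : hom C S N) : is_biproduct i1 i2 p1 p2 -> forall x,
  [/\ lker (nat_at i1 x) = 0%VS, lker (nat_at i2 x) = 0%VS,
      limg (nat_at p1 x) = fullv, limg (nat_at p2 x) = fullv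
    & limg (nat_at i1 x) = lker (nat_at p2 x)].
Proof.
case=> p1i1 p2i2 p2i1 p1i2 sum x.
have c1 : cancel (nat_at i1 x) (nat_at p1 x).
  by move=> v; rewrite -nat_at_comp p1i1 nat_at_id.
have c2 : cancel (nat_at i2 x) (nat_at p2 x).
  by move=> v; rewrite -nat_at_comp p2i2 nat_at_id.
split.
- by apply/eqP/lker0P; apply: can_inj c1.
- by apply/eqP/lker0P; apply: can_inj c2.
- apply/vspaceP => v; rewrite memvf; apply/memv_imgP.
  by exists (nat_at i1 x v); rewrite ?memvf ?c1.
- apply/vspaceP => v; rewrite memvf; apply/memv_imgP.
  by exists (nat_at i2 x v); rewrite ?memvf ?c2.
apply/eqP; rewrite eqEsubv; apply/andP; split; first by move/comp0_at: p2i1.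
apply/subvP => v; rewrite memv_ker => /eqP v0.
rewrite -[v]nat_at_id -sum nat_atD add_lfunE !nat_at_comp v0 linear0 addr0.
by rewrite memv_img ?memvf.
Qed.

(** Coproducts are given by their universal property, and this recovers pointwise information: the
    quotient map by [T] and the zero map agree on all injections, hence are equal. *)
Lemma coproduct_gen (J : Type) (X : J -> rep k Q) S
    (inj : forall j, hom C (X j) S) (T : forall x, {vspace S x}) :
  is_coproduct inj -> stable T ->
  (forall j x, (limg (nat_at (inj j) x) <= T x)%VS) -> forall x, T x = fullv.
Proof.
move=> cop T_st injT x; have [N [q qP]] := ex_quotrep T_st.
have [u [_ u_uniq]] := cop N (fun j => 0).
have q0 : q = 0.
  rewrite -(u_uniq q) ?(u_uniq 0) // => j; first by rewrite lc_comp0l.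
  by apply/comp0_at => y; have [_ ->] := qP y.
have [_ <-] := qP x; rewrite q0 nat_at0; apply/vspaceP => v.
by rewrite memv_ker zero_lfunE eqxx memvf.
Qed.

Lemma coproduct_retract (J : Type) (X : J -> rep k Q) S
    (inj : forall j, hom C (X j) S) :
  is_coproduct inj -> forall j, exists p, comp C p (inj j) = idm C (X j).
Proof.
move=> cop j.
(* The identity at the index [j], transported along [i = j], and zero at all others. *)
pose h i : hom C (X i) (X j) := if pselect (i = j) is left e
  then eq_rect i (fun l => hom C (X i) (X l)) (idm C (X i)) j e else 0.
have [u [uh _]] := cop _ h; exists u; rewrite uh /h.
by case: pselect => // e; rewrite (Prop_irrelevance e erefl).
Qed.

End Representations.

(** * Restriction to a thread and extension by zero *)

Section Threads.
Variables (k : fieldType) (Q : thread_quiver).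
Local Notation C := (rep_pwf k Q).
Implicit Types (M N W : rep k Q) (x y z : obj Q) (a : arrow Q).

Lemma bar_le_refl a : reflexive (@bar_le Q a).
Proof. by case=> //= p; apply: Order.POrderTheory.lexx. Qed.

Lemma bar_le_total a : total (@bar_le Q a).
Proof.
by case=> [|p|] [|q|] //=; apply: Order.TotalTheory.le_total.
Qed.

Lemma bar_le_min a (b : bar a) : bar_le (BMin a) b.
Proof. by []. Qed.

(** The value 0 off the order only serves to make the map total, as [pmod] requires. *)
Definition bar_map M a (b c : bar a) : 'Hom(M (bar_obj b), M (bar_obj c)) :=
  if pselect (bar_le b c) is left bc then rmap M << eta bc >> else 0.

Lemma bar_mapE M a (b c : bar a) (bc : bar_le b c) :
  bar_map M b c = rmap M << eta bc >>.
Proof.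
by rewrite /bar_map; case: pselect => // bc'; rewrite (bool_irrelevance bc' bc).
Qed.

Program Definition tmod M a : pmod k (@bar_le Q a) :=
  @PMod k (bar a) (@bar_le Q a) (fun b => M (bar_obj b)) (@bar_map M a) _ _.
Next Obligation.
apply/lfunP => v; rewrite (bar_mapE M (bar_le_refl i)) eta_id rmap_id.
by rewrite id_lfunE.
Qed.
Next Obligation.
rename H into ij; rename H0 into jl; apply/lfunP => v.
rewrite comp_lfunE (bar_mapE M ij) (bar_mapE M jl) -rmapU eta_comp.
by rewrite (bar_mapE M (bar_le_trans ij jl)).
Qed.

Lemma tmod_hom M N (u : hom C M N) a :
  @pm_hom k _ _ (tmod M a) (tmod N a) (fun b => nat_at u (bar_obj b)).
Proof. by move=> b c v bc; rewrite /= !(bar_mapE _ bc) nat_atN. Qed.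

Definition off_thread a x : Prop := forall p : thread a, x <> Pt p.

Lemma off_Pt a c (p : thread c) : c <> a -> off_thread a (Pt p).
Proof.
move=> ca q pq; apply: ca.
by have [] : Some c = Some a :=
  congr1 (fun x : obj Q => if x is @Pt _ b _ then Some b else None) pq.
Qed.

Lemma off_threadP a x : off_thread a x \/ exists p : thread a, x = Pt p.
Proof.
have [[p ->]|H] := pselect (exists p : thread a, x = Pt p).
  by right; exists p.
by left=> p xp; apply: H; exists p.
Qed.

Lemma supp_off M a x (v : M x) : supp_in_thread M a -> off_thread a x -> v = 0.
Proof.
move=> Ma ax; apply: (dimvf_eq0P _).1.
have [//|/eqP /Ma [p]] := eqVneq (\dim {:M x}) 0%N.
by move/ax.
Qed.

Section AtThread.
Variables (a : arrow Q) (T : obj Q -> Type) (t0 : forall x, T x)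
  (h : forall p : thread a, T (Pt p)).

(** [thread c] depends on [c], so [h] has to be transported along [a = c] before it applies to
    [q]. *)
Definition at_thread x : T x :=
  match x with
  | Vtx v => t0 (Vtx v)
  | Pt c q => if pselect (a = c) is left e
    then eq_rect a (fun c => forall q : thread c, T (Pt q)) h c e q
    else t0 (Pt q)
  end.

Lemma at_threadE p : at_thread (Pt p) = h p.
Proof.
rewrite /at_thread; case: pselect => // e.
by rewrite (Prop_irrelevance e erefl).
Qed.

Lemma at_thread_off x : off_thread a x -> at_thread x = t0 x.
Proof.
case: x => //= c q ax; case: pselect => // e; case: _ / e q ax => q ax.
by case: (ax q).
Qed.

End AtThread.

Lemma enter_thread M a (q : thread a) x (p : qpath (leave x) (source a)) v :
  rmap M << @Through Q x (Pt q) p >> v =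
  bar_map M (BMin a) (BPt q) (rmap M << @Through Q x (Vtx (source a)) p >> v).
Proof. by rewrite (bar_mapE M (isT : bar_le (BMin a) (BPt q))) -rmapU. Qed.

Lemma leave_thread M a (q : thread a) y (p : qpath (target a) (enter y)) v :
  rmap M << @Through Q (Pt q) y p >> v =
  rmap M << @Through Q (Vtx (target a)) y p >> (bar_map M (BPt q) (BMax a) v).
Proof.
by rewrite (bar_mapE M (isT : bar_le (BPt q) (BMax a))) -rmapU /= !pcat_nil.
Qed.

(** A path-like element touching the open thread is either an [Eta], where [h] is natural, or a
    [Through]. The latter enters over [BMin] and leaves over [BMax], where [h] vanishes, so both
    sides of the naturality square are zero. *)
Lemma ex_thread_nat a M N
    (h : forall b : bar a, 'Hom(M (bar_obj b), N (bar_obj b))) :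
  @pm_hom k _ _ (tmod M a) (tmod N a) h -> h (BMin a) = 0 -> h (BMax a) = 0 ->
  exists H : hom C M N, (forall b : bar a, nat_at H (bar_obj b) = h b) /\
    forall x, off_thread a x -> nat_at H x = 0.
Proof.
move=> h_hom h_min h_max.
pose H := at_thread (T := fun x => 'Hom(M x, N x)) (fun=> 0)
  (fun p => h (BPt p)).
have HE (p : thread a) : H (Pt p) = h (BPt p) by apply: at_threadE.
have H0 x : off_thread a x -> H x = 0 by apply: at_thread_off.
have [|w wE] := @mk_nat k Q M N H; last first.
  exists w; split=> [[|p|]|x ax]; rewrite wE ?HE ?H0 ?h_min ?h_max //.
move=> x y g v; case: g v => {x y} [x y p|c p q pq] v.
  have -> : H y (rmap M << Through p >> v) = 0.
    have [/H0 ->|[q yq]] := off_threadP a y; first by rewrite zero_lfunE.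
    subst y; rewrite enter_thread HE.
    by rewrite (h_hom (BMin a) (BPt q)) // h_min zero_lfunE linear0.
  have [/H0 ->|[q xq]] := off_threadP a x; first by rewrite zero_lfunE linear0.
  subst x; rewrite leave_thread HE.
  have <- := h_hom (BPt q) (BMax a) v isT.
  by rewrite h_max zero_lfunE linear0.
have [ca|ca] := pselect (c = a); last first.
  by rewrite !H0 ?zero_lfunE ?linear0 //; apply: off_Pt.
subst c; rewrite !HE.
have := h_hom (BPt p) (BPt q) v pq.
by rewrite /= !(bar_mapE _ (pq : bar_le (BPt p) (BPt q))).
Qed.

(** A possibly infinite sum with at most one nonzero term at each object. Between points of
    different threads both sides of naturality vanish. *)
Lemma ex_glue M N (h : arrow Q -> hom C M N) :
  (forall a x, off_thread a x -> nat_at (h a) x = 0) ->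
  exists g : hom C M N,
    (forall a (p : thread a), nat_at g (Pt p) = nat_at (h a) (Pt p)) /\
    forall v, nat_at g (Vtx v) = 0.
Proof.
move=> h_off.
pose g x : 'Hom(M x, N x) :=
  match x with Vtx v => 0 | Pt a p => nat_at (h a) (Pt p) end.
have [|w wE] := @mk_nat k Q M N g; last first.
  by exists w; split=> [a p|v]; rewrite wE.
move=> [u|a p] [v|b q] f m /=.
- by rewrite !zero_lfunE linear0.
- by rewrite nat_atN (h_off b (Vtx u)) ?zero_lfunE ?linear0.
- by rewrite -nat_atN (h_off a (Vtx v)) ?zero_lfunE.
have [ab|ab] := pselect (a = b); first by subst b; rewrite nat_atN.
have /off_Pt bp := ab; have /off_Pt aq := nesym ab.
rewrite nat_atN (h_off b (Pt p)) // -nat_atN (h_off a (Pt q)) //.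
by rewrite !zero_lfunE linear0.
Qed.

Definition bounded M a : Prop := exists n, forall (x : bar a) s,
  path (@bar_le Q a) x s -> (cnt (tmod M a) x s <= n)%N.

(** There is no noise at any point of the thread of [a]. *)
Definition reduced M a : Prop := forall b : bar a,
  (lker (bar_map M b (BMax a)) <= limg (bar_map M (BMin a) b))%VS.

Lemma reduced_bounded M a : reduced M a -> bounded M a.
Proof.
move=> red; eexists => x s xs.
exact: (cnt_reduced (E := tmod M a) (@bar_le_min a) (@bar_le_max Q a) red).
Qed.

Lemma bounded_sub M N (u : hom C M N) a :
  (forall x, lker (nat_at u x) = 0%VS) -> bounded N a -> bounded M a.
Proof.
move=> u_inj [n Nn]; exists n => x s xs; apply: leq_trans (Nn x s xs).
by apply: (cnt_sub (tmod_hom u (a := a))) => // b; apply: u_inj.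
Qed.

Lemma bounded_quot M N (u : hom C M N) a :
  (forall x, limg (nat_at u x) = fullv) -> bounded M a -> bounded N a.
Proof.
move=> u_onto [n Mn]; exists n => x s xs; apply: leq_trans (Mn x s xs).
by apply: (cnt_quot (tmod_hom u (a := a))) => // b; apply: u_onto.
Qed.

Lemma bounded_ext M N W (u : hom C M N) (w : hom C N W) a :
  (forall x, lker (nat_at u x) = 0%VS) ->
  (forall x, limg (nat_at u x) = lker (nat_at w x)) ->
  bounded M a -> bounded W a -> bounded N a.
Proof.
move=> u_inj uw [m Mm] [n Wn]; exists (m + n)%N => x s xs.
apply: leq_trans (leq_add (Mm x s xs) (Wn x s xs)).
apply: (cnt_ext (tmod_hom u (a := a)) (tmod_hom w (a := a))) => // b.
  exact: u_inj.
by rewrite uw.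
Qed.

(** The trace that an interval module in the open thread leaves in the count. *)
Definition thin M a : Prop := [/\ supp_in_thread M a, ~ is_zero C M
  & forall (x : bar a) s, path (@bar_le Q a) x s ->
      (cnt (tmod M a) x s <= 1)%N].

(** The idempotent of [interval_summand] vanishes at both ends, extends by zero to [M], and splits
    there; [V] is its image. *)
Lemma thin_summand M a : ~ reduced M a ->
  exists N V, direct_sum C N V M /\ thin V a.
Proof.
move=> /asboolP; rewrite asbool_neg => /existsp_asboolPn [b /negP noisy].
have [h [h_hom h_idem [h_min h_max hb] h_dim h_inj]] :=
  @interval_summand k (bar a) (@bar_le Q a) (tmod M a) (@bar_le_refl a)
    (@bar_le_trans Q a) (@bar_le_total a) (BMin a) (BMax a) (@bar_le_min a)
    (@bar_le_max Q a) b noisy.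
have [||//|e [eE e_off]] := @ex_thread_nat a M M h.
- by move=> i j v ij; rewrite -!comp_lfunE h_hom.
- by [].
have ee : comp C e e = e.
  apply: nat_ext => x v; rewrite nat_at_comp.
  have [/e_off ->|[p xp]] := off_threadP a x; first by rewrite !zero_lfunE.
  by subst x; rewrite -[Pt p]/(bar_obj (BPt p)) eE -comp_lfunE h_idem.
have [N [V [i [i' [p [p' [sum ie]]]]]]] := split_idem_sum ee.
have at_x x := biproduct_at sum x.
have i'_inj x : lker (nat_at i' x) = 0%VS by have [] := at_x x.
have p'_onto x : limg (nat_at p' x) = fullv by have [] := at_x x.
have i'_img x : limg (nat_at i' x) = limg (nat_at e x).
  have -> : nat_at e x = (nat_at i' x \o nat_at p' x)%VF by rewrite -ie.
  by rewrite limg_comp p'_onto.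
have dimV x : \dim {:V x} = \dim (limg (nat_at e x)).
  by rewrite -i'_img limg_dim_eq // i'_inj capv0.
exists N, V; split; first by exists i, i', p, p'.
split.
- move=> x; rewrite /supp dimV.
  have [/e_off ->|//] := off_threadP a x.
  by rewrite lim0g dimv0.
- move=> /is_zeroP V0; case/negP: hb; rewrite -eE; apply/eqP/lfunP => v.
  apply/eqP; rewrite zero_lfunE -memv0.
  rewrite -(eqP (_ : limg (nat_at e (bar_obj b)) == 0)%VS) ?memv_img ?memvf //.
  by rewrite -dimv_eq0 -dimV V0.
move=> x s; apply: (cnt_thin (@bar_le_trans Q a) (@bar_le_total a)).
  by move=> c; rewrite /= dimV eE; apply: h_dim.
have h0 c : \dim {:tmod V a c} <> 0%N -> h c != 0.
  rewrite /= dimV eE => V0; apply/eqP => h0; case: V0.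
  by rewrite h0 lim0g dimv0.
move=> c d cd /h0 hc /h0 hd; apply/eqP; rewrite -subv0; apply/subvP => v.
rewrite memv_ker => /eqP fv.
rewrite -(i'_inj (bar_obj c)) memv_ker -memv0 -(h_inj _ _ cd hc hd) memv_cap.
rewrite -eE -i'_img memv_img ?memvf //= memv_ker.
have <- := tmod_hom i' v cd; by rewrite /= fv linear0.
Qed.

End Threads.

(** * Formal properties of direct sums in a linear category *)

Section DirectSums.
Variables (k : fieldType) (T : Type) (C : lincat k T).

Lemma direct_sum_zero (X Z : T) : is_zero C Z -> direct_sum C X Z X.
Proof.
move=> Z0; have [Zl Zr] := Z0 X; have [Zz _] := Z0 Z.
exists (idm C X), 0, (idm C X), 0; split.
- by rewrite lc_comp1m.
- by rewrite [RHS]Zz [LHS]Zz.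
- by rewrite lc_comp0l.
- by rewrite lc_comp0r.
- by rewrite lc_comp1m lc_comp0l addr0.
Qed.

Lemma direct_sum_assoc (X Y Z S YZ XY : T) :
  direct_sum C XY Z S -> direct_sum C X Y XY -> direct_sum C Y Z YZ ->
  direct_sum C X YZ S.
Proof.
case=> [i [iZ [p [pZ [pi pZiZ pZi piZ iS]]]]].
case=> [jX [jY [qX [qY [qjX qjY qYjX qXjY jXY]]]]].
case=> [lY [lZ [rY [rZ [rlY rlZ rZlY rYlZ lYZ]]]]].
exists (comp C i jX), (comp C (comp C i jY) rY + comp C iZ rZ),
  (comp C qX p), (comp C lY (comp C qY p) + comp C lZ pZ).
have can U V W (f : hom C V W) g (h : hom C U V) :
    comp C g f = idm C V -> comp C g (comp C f h) = h.
  by rewrite lc_compA => ->; rewrite lc_comp1m.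
have can0 U V V' W (f : hom C V W) (g : hom C W V') (h : hom C U V) :
    comp C g f = 0 -> comp C g (comp C f h) = 0.
  by rewrite lc_compA => ->; rewrite lc_comp0l.
split; rewrite ?lc_compDl ?lc_compDr -?lc_compA.
- by rewrite (can _ _ _ i).
- rewrite !(can _ _ _ i) // (can _ _ _ jY) // (can0 _ _ _ _ iZ) //.
  by rewrite (can0 _ _ _ _ i) // (can _ _ _ iZ) // !lc_comp0r addr0 add0r.
- by rewrite (can _ _ _ i) // (can0 _ _ _ _ i) // qYjX !lc_comp0r addr0.
- rewrite (can _ _ _ i) // (can0 _ _ _ _ jY) // (can0 _ _ _ _ iZ) //.
  by rewrite !lc_comp0r addr0.
rewrite (can _ _ _ lY) // (can0 _ _ _ _ lZ) // (can0 _ _ _ _ lY) //.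
rewrite (can _ _ _ lZ) // !lc_comp0r addr0 add0r addrA -lc_compDr.
by rewrite 2!(lc_compA jX, lc_compA jY) -lc_compDl jXY lc_comp1m.
Qed.

Lemma direct_sum_coproduct (X Y S W : T) (i1 : hom C X S) (i2 : hom C Y S) p1 p2
    (f : hom C X W) (g : hom C Y W) : is_biproduct i1 i2 p1 p2 ->
  exists! u : hom C S W, comp C u i1 = f /\ comp C u i2 = g.
Proof.
case=> pi1 pi2 p2i1 p1i2 sum; exists (comp C f p1 + comp C g p2); split.
  rewrite !lc_compDl -!lc_compA pi1 pi2 p2i1 p1i2 !lc_compm1 !lc_comp0r.
  by rewrite addr0 add0r.
move=> u [<- <-]; rewrite -!lc_compA -lc_compDr sum.
by rewrite lc_compm1.
Qed.

(** Appends one summand, indexed by [None]; reindexing then gives families over ['I_n.+1]. *)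
Lemma direct_sum_fam_option (J : Type) (V : J -> T) (X Y S : T) :
  direct_sum_fam C V X -> direct_sum C X Y S ->
  direct_sum_fam C (oapp V Y) S.
Proof.
move=> [inj cop] [i1 [i2 [p1 [p2 sum]]]].
exists (fun o => match o return hom C (oapp V Y o) S with
  | Some j => comp C i1 (inj j) | None => i2 end).
move=> W h; have [f [fh f_uniq]] := cop W (fun j => h (Some j)).
have [u [[uf uh] u_uniq]] := direct_sum_coproduct f (h None) sum.
exists u; split=> [[j|] //|u' u'h]; first by rewrite lc_compA uf fh.
apply: u_uniq; split; last exact: (u'h None).
by apply/esym/f_uniq => j; rewrite -lc_compA (u'h (Some j)).
Qed.

Lemma direct_sum_fam_reindex (J J' : Type) (phi : J -> J') (psi : J' -> J)
    (X : J' -> T) S : cancel phi psi -> cancel psi phi ->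
  direct_sum_fam C X S -> direct_sum_fam C (X \o phi) S.
Proof.
move=> phiK psiK [inj cop]; exists (fun j => inj (phi j)) => W h.
pose h' j' : hom C (X j') W :=
  eq_rect _ (fun j' => hom C (X j') W) (h (psi j')) j' (psiK j').
have h'E j : h' (phi j) = h j.
  rewrite /h'; move: (psiK (phi j)); rewrite phiK => e.
  by rewrite (Prop_irrelevance e erefl).
have [u [uh u_uniq]] := cop W h'; exists u; split=> [j|u' u'h].
  by rewrite uh h'E.
by apply: u_uniq => j'; rewrite -(psiK j') u'h h'E.
Qed.

Lemma direct_sum_fam_empty (Z : T) (V : 'I_0 -> T) :
  is_zero C Z -> direct_sum_fam C V Z.
Proof.
move=> Z0; exists (fun j => 0) => W h; have [z _] := Z0 W.
by exists 0; split=> [[]|u _] //; rewrite [RHS]z.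
Qed.

End DirectSums.

(** * Quasi noise free means bounded on every thread; consequences *)

Section Criterion.
Variables (k : fieldType) (Q : thread_quiver).
Local Notation C := (rep_pwf k Q).
Implicit Types (M N W V : rep k Q) (x y z : obj Q) (a : arrow Q).

Lemma direct_sum_dim M N S x : direct_sum C M N S ->
  \dim {:S x} = (\dim {:M x} + \dim {:N x})%N.
Proof.
case=> [i1 [i2 [p1 [p2 sum]]]].
have [i1_inj i2_inj p1_onto p2_onto ip] := biproduct_at sum x.
rewrite -(limg_ker_dim (nat_at p2 x)) capfv -ip p2_onto limg_dim_eq //.
by rewrite i1_inj capv0.
Qed.

Lemma not_zero_supp M : ~ is_zero C M -> exists x, supp M x.
Proof.
move=> M0; have [//|nsupp] := pselect (exists x, supp M x).
case: M0; apply/is_zeroP => x.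
by have [//|/eqP Mx] := eqVneq (\dim {:M x}) 0%N; case: nsupp; exists x.
Qed.

Lemma direct_sum_cnt M N S a (x : bar a) s : direct_sum C M N S ->
  path (@bar_le Q a) x s ->
  (cnt (tmod M a) x s + cnt (tmod N a) x s <= cnt (tmod S a) x s)%N.
Proof.
case=> [i1 [i2 [p1 [p2 sum]]]].
apply: (cnt_add (tmod_hom i1 (a := a)) (tmod_hom i2 (a := a))) => b;
  have [i1_inj i2_inj _ _ ip] := biproduct_at sum (bar_obj b);
  [exact: i1_inj | exact: i2_inj |].
apply/eqP; rewrite -subv0 ip; apply/subvP => v.
move=> /memv_capP [+ /memv_imgP [u _ uv]].
have [_ pi2 _ _ _] := sum.
rewrite uv memv_ker -nat_at_comp pi2 nat_at_id => /eqP ->.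
by rewrite linear0 mem0v.
Qed.

(** If both summands were nonzero, a chain through a support point of each would count at least two
    intervals. *)
Lemma thin_indecomposable M a : thin M a -> indecomposable C M.
Proof.
case=> Ma M0 M1; split=> // Y Z YZ.
have [|/not_zero_supp [y Yy]] := pselect (is_zero C Y); first by left.
have [|/not_zero_supp [z Zz]] := pselect (is_zero C Z); first by right.
have dimM x := direct_sum_dim x YZ.
have [|p yp] := Ma y.
  by rewrite /supp dimM => /eqP; rewrite addn_eq0 => /andP [/eqP /Yy].
have [|q zq] := Ma z.
  by rewrite /supp dimM => /eqP; rewrite addn_eq0 => /andP [_ /eqP /Zz].
subst y z.
have [x [s [xs le_s q_s]]] := cnt_insert k (@bar_le_total Q a)
  (BPt q) (isT : path (@bar_le Q a) (BPt p) [::]).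
have := M1 x s xs; rewrite leqNgt => /negP [].
apply: leq_trans (direct_sum_cnt YZ xs).
rewrite -addn1; apply: leq_add.
  by apply: leq_trans (le_s (tmod Y a)); rewrite /= lt0n; apply/eqP.
by apply: leq_trans (q_s (tmod Z a)); rewrite lt0n; apply/eqP.
Qed.

(** With both ends zero, the kernel of the map to [max] is everything and the image of [min] is
    zero. *)
Lemma noise_reduced_off M a : (forall v, ~ supp M (Vtx v)) -> reduced M a ->
  forall p : thread a, ~ supp M (Pt p).
Proof.
move=> M_noise red p; apply; apply/dimvf_eq0P => m.
have M0 v (m' : M (Vtx v)) : m' = 0.
  apply: (dimvf_eq0P _).1.
  by have [//|/eqP Mv] := eqVneq (\dim {:M (Vtx v)}) 0%N; case: (M_noise v).
have := subvP (red (BPt p)) m.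
rewrite memv_ker [bar_map _ _ _ _]M0 eqxx => /(_ isT) /memv_imgP [u _ ->].
by rewrite [u]M0 linear0.
Qed.

Lemma noise_free_reduced M a : noise_free M -> reduced M a.
Proof.
move=> Mnf; have [//|noisy] := pselect (reduced M a).
have [N [V [NV [Va V0 _]]]] := thin_summand noisy.
case: V0; apply: Mnf; last by move=> v /Va [].
by exists N; case: NV => [i [i' [p [p' [pi pi' p'i pi'0 sum]]]]];
  exists i', i, p', p; split=> //; rewrite addrC.
Qed.

(** The retraction is asked only along the thread of [a] and its ends, which is where the two
    idempotents compared in [qnf_of_bounded] agree. *)
Lemma reduced_retract M N a (u : hom C N M) (w : hom C M N) :
  (forall b : bar a, cancel (nat_at u (bar_obj b)) (nat_at w (bar_obj b))) ->
  reduced M a -> reduced N a.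
Proof.
move=> uK red b; apply/subvP => v; rewrite memv_ker => /eqP v0.
have : nat_at u (bar_obj b) v \in lker (bar_map M b (BMax a)).
  by rewrite memv_ker; have /= <- := tmod_hom u (a := a) v (bar_le_max b);
    rewrite v0 linear0.
case/(subvP (red b))/memv_imgP => m _ uv; apply/memv_imgP.
exists (nat_at w (bar_obj (BMin a)) m); first exact: memvf.
have /= <- := tmod_hom w (a := a) m (bar_le_min b).
by rewrite -uv uK.
Qed.

Lemma reduced_noise_free M : (forall a, reduced M a) -> noise_free M.
Proof.
move=> red N [N' [i [_ [p [_ [pi _ _ _ _]]]]]] N_noise.
apply/is_zeroP => x; have [//|/eqP Nx] := eqVneq (\dim {:N x}) 0%N.
case: x Nx => [v /N_noise //|a q].
case/(noise_reduced_off N_noise).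
apply: (reduced_retract (u := i) (w := p)) (red a) => b v.
by rewrite -nat_at_comp pi nat_at_id.
Qed.

(** Being nonzero and supported in the thread, [M] is not reduced, so a thin [V] splits off. Its
    complement is zero, and [M] embeds into [V]. *)
Lemma indecomposable_cnt M a : indecomposable C M -> supp_in_thread M a ->
  forall (x : bar a) s, path (@bar_le Q a) x s -> (cnt (tmod M a) x s <= 1)%N.
Proof.
move=> [M0 indec] Ma.
have [/noise_reduced_off Moff|noisy] := pselect (reduced M a).
  have [x Mx] := not_zero_supp M0; have [p xp] := Ma x Mx.
  by subst x; case: (Moff _ p) => // v /Ma [].
have [N [V [NV [_ V0 V1]]]] := thin_summand noisy.
move=> x s xs; have [/is_zeroP N0|//] := indec _ _ NV.
apply: leq_trans (V1 x s xs); case: NV => [i [i' [p [p' sum]]]].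
apply: (cnt_sub (tmod_hom p' (a := a))) => // b.
have [_ _ _ _ <-] := biproduct_at sum (bar_obj b).
have /eqP : \dim {:N (bar_obj b)} = 0%N by apply: N0.
by rewrite dimv_eq0 => /eqP ->; rewrite limg0.
Qed.

(** The bound is the number of summands: their images generate [M], and each counts at most one
    interval. *)
Lemma finite_sum_bounded M a : supp_in_thread M a -> finite_sum_indec M ->
  bounded M a.
Proof.
move=> Ma [n [V [V_indec [inj cop]]]]; exists n => x s xs.
have Va j : supp_in_thread (V j) a.
  move=> y Vy; apply: Ma => /dimvf_eq0P My; apply: Vy; apply/dimvf_eq0P => v.
  have [p pi] := coproduct_retract cop j.
  by rewrite -[v]nat_at_id -pi nat_at_comp [nat_at (inj j) y v]My linear0.
pose T y := (\sum_j limg (nat_at (inj j) y))%VS.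
have T_st : stable T.
  move=> y z p _ /memv_sumP [u uV ->]; rewrite linear_sum.
  apply: memv_sumr => j _; apply: (@stable_img k Q _ _ (inj j)); exact: uV.
have TE : forall y, T y = fullv.
  apply: (coproduct_gen cop T_st) => j y; exact: (sumv_sup j).
apply: (@leq_trans (\sum_(j < n) 1)%N); last by rewrite sum1_card card_ord.
apply: leq_trans (cnt_gen (E := fun j => tmod (V j) a) (F := tmod M a)
  (g := fun j b => nat_at (inj j) (bar_obj b))
  (fun j => tmod_hom (inj j) (a := a)) _ xs) _.
  by move=> b; rewrite -TE.
by apply: leq_sum => j _; apply: indecomposable_cnt.
Qed.

(** On the thread of [a] only [U a] contributes: the images of the [U c], each on its own thread,
    already form a subrepresentation containing all injections. *)
Lemma thread_sum_bounded M (U : arrow Q -> rep k Q) a :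
  direct_sum_fam C U M -> (forall c, supp_in_thread (U c) c) ->
  bounded (U a) a -> bounded M a.
Proof.
move=> [inj cop] Uc [n Un]; exists n => x s xs.
pose T y : {vspace M y} := match y with
  | Vtx v => 0%VS | Pt c p => limg (nat_at (inj c) (Pt p)) end.
have T_st : stable T.
  move=> [v|c p] z g u /=.
    by rewrite memv0 => /eqP ->; rewrite linear0 mem0v.
  case/memv_imgP => w _ ->; rewrite -nat_atN.
  have [cz|[q zq]] := off_threadP c z; last by subst z; rewrite memv_img ?memvf.
  by rewrite [rmap _ _ _](supp_off _ (Uc c) cz) linear0 mem0v.
have TE : forall y, T y = fullv.
  apply: (coproduct_gen cop T_st) => c y; apply/subvP => _ /memv_imgP [u _ ->].
  have [cy|[q yq]] := off_threadP c y; last by subst y; rewrite memv_img ?memvf.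
  by rewrite [u](supp_off _ (Uc c) cy) linear0 mem0v.
apply: leq_trans (Un x s xs).
apply: (cnt_quot (tmod_hom (inj a) (a := a))) => // b.
have : (T (bar_obj b) <= limg (nat_at (inj a) (bar_obj b)))%VS.
  by case: b => [|p|] /=; rewrite ?sub0v.
by rewrite TE => full; apply/eqP; rewrite eqEsubv subvf.
Qed.

Lemma bounded_of_qnf M a : quasi_noise_free M -> bounded M a.
Proof.
case=> MNF [W [U [[i [i' [p [p' sum]]]] UW nf Ua Uf]]].
apply: (bounded_ext (u := i) (w := p')) => [x|x||].
- by have [] := biproduct_at sum x.
- by have [] := biproduct_at sum x.
- exact/reduced_bounded/noise_free_reduced.
- apply: (thread_sum_bounded UW Ua).
  by apply: finite_sum_bounded; [apply: Ua|apply: Uf].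
Qed.

Lemma finite_sum_zero M : is_zero C M -> finite_sum_indec M.
Proof.
move=> M0; exists 0%N, (fun _ => M); split; first by case.
exact: direct_sum_fam_empty.
Qed.

Lemma finite_sum_snoc M N S : finite_sum_indec M -> indecomposable C N ->
  direct_sum C M N S -> finite_sum_indec S.
Proof.
case=> [n [V [V_indec MV]]] N_indec MNS.
have can1 : cancel (unlift (@ord_max n)) (oapp (lift ord_max) ord_max).
  by move=> j; case: unliftP => [i|] ->.
have can2 : cancel (oapp (lift ord_max) ord_max) (unlift (@ord_max n)).
  by move=> [i|] /=; rewrite ?liftK ?unlift_none.
exists n.+1, (oapp V N \o unlift ord_max); split.
  by move=> j /=; case: (unlift _ j).
exact: (direct_sum_fam_reindex can1 can2 (direct_sum_fam_option MV MNS)).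
Qed.

(** The strict drop that ends the splitting: any chain for [N] can be refined through a point where
    [V] is nonzero, and there [V] counts at least one. *)
Lemma thin_complement_cnt M N V a n : direct_sum C N V M -> thin V a ->
  (forall (x : bar a) s, path (@bar_le Q a) x s ->
    (cnt (tmod M a) x s <= n)%N) ->
  forall (x : bar a) s, path (@bar_le Q a) x s -> (cnt (tmod N a) x s < n)%N.
Proof.
move=> NV [Va /not_zero_supp [z Vz] _] Mn x s xs.
have [p zp] := Va z Vz; subst z.
have [x' [s' [xs' le_s' p_s']]] := cnt_insert k (@bar_le_total Q a) (BPt p) xs.
apply: leq_trans (Mn x' s' xs'); apply: leq_trans (direct_sum_cnt NV xs').
rewrite -addn1; apply: leq_add (le_s' (tmod N a)) _.
by apply: leq_trans (p_s' (tmod V a)); rewrite lt0n; apply/eqP.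
Qed.

Lemma thread_decomposition M a : bounded M a -> exists N U,
  [/\ direct_sum C N U M, supp_in_thread U a, finite_sum_indec U & reduced N a].
Proof.
case=> n; elim: n M => [|n IH] M Mn;
  (have [red|/thin_summand [M1 [V [M1V thinV]]]] := pselect (reduced M a);
    first by exists M, (zero_rep k Q); split=> //;
      [apply/direct_sum_zero/zero_rep_zero
      |move=> x []; move: x; apply/is_zeroP/zero_rep_zero
      |apply/finite_sum_zero/zero_rep_zero]);
  have M1n := thin_complement_cnt M1V thinV Mn.
  (* With bound 0 nothing can split off: the complement would have a negative count. *)
  by have := M1n (BMin a) [::] isT; rewrite ltn0.
have [N [U [NU Ua Uf Nred]]] := IH M1 M1n.
have UV := direct_sum_rep U V.
exists N, (sum_rep U V); split=> //.
- exact: direct_sum_assoc M1V NU UV.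
- move=> x; rewrite /supp (direct_sum_dim x UV) => /eqP.
  rewrite addn_eq0 negb_and => /orP [/eqP /Ua //|/eqP Vx].
  by case: thinV => Va _ _; apply: Va.
- exact: finite_sum_snoc Uf (thin_indecomposable thinV) UV.
Qed.

(* The idempotents cutting out the noise of the various threads live on
   disjoint sets of objects, so they can be added up. *)
Lemma qnf_of_bounded M : (forall a, bounded M a) -> quasi_noise_free M.
Proof.
move=> Mb.
pose P a U (i : hom C U M) (p : hom C M U) := [/\ comp C p i = idm C U,
  supp_in_thread U a, finite_sum_indec U
  & exists N (j : hom C N M) (q : hom C M N),
      reduced N a /\ comp C j q + comp C i p = idm C M].
have /choice [U exU] : forall a, exists U i p, @P a U i p.
  move=> a; have [N [U [[j [i [q [p [_ pi _ _ sum]]]]] Ua Uf Nred]]] :=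
    thread_decomposition (Mb a).
  by exists U, i, p; split=> //; exists N, j, q.
pose i a := sval (cid (exU a)).
have exi a : exists p, P a (U a) (i a) p by rewrite /i; case: cid.
pose p a := sval (cid (exi a)).
have ipP a : P a (U a) (i a) (p a) by rewrite /p; case: cid.
have Ua a : supp_in_thread (U a) a by case: (ipP a).
have pi a x u : nat_at (p a) x (nat_at (i a) x u) = u.
  by rewrite -nat_at_comp; case: (ipP a) => -> _ _ _; rewrite nat_at_id.
have [|e [ePt eVtx]] := @ex_glue k Q M M (fun a => comp C (i a) (p a)).
  move=> a x ax; apply/lfunP => v; rewrite nat_at_comp zero_lfunE.
  by rewrite [nat_at (p a) x v](supp_off _ (Ua a) ax) linear0.
have eE a (q : thread a) v :
    nat_at e (Pt q) v = nat_at (i a) (Pt q) (nat_at (p a) (Pt q) v).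
  by rewrite ePt nat_at_comp.
have ee : comp C e e = e.
  apply: nat_ext => -[v|a q] m; rewrite nat_at_comp.
    by rewrite eVtx !zero_lfunE.
  by rewrite !eE pi.
have [MNF [W [l [l' [r [r' [sum l'r']]]]]]] := split_idem_sum ee.
have [rl r'l' r'l rl' lrl'r'] := sum.
have l'E x v : nat_at l' x v = nat_at e x (nat_at l' x v).
  by rewrite -l'r' nat_at_comp -[nat_at r' _ _]nat_at_comp r'l' nat_at_id.
have r'K x v : nat_at r' x (nat_at l' x v) = v.
  by rewrite -nat_at_comp r'l' nat_at_id.
exists MNF, W, U; split; first by exists l, l', r, r'.
(* [W] is zero at the vertices and is the image of [i a] on the thread of [a], so the mediating map
   has to be [h a \o p a \o l'] there; [ex_glue] makes it natural. *)
- exists (fun a => comp C r' (i a)) => X h.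
  have [|g [gPt gVtx]] := @ex_glue k Q W X
    (fun a => comp C (h a) (comp C (p a) l')).
    move=> a x ax; apply/lfunP => v; rewrite !nat_at_comp zero_lfunE.
    by rewrite [nat_at (p a) x _](supp_off _ (Ua a) ax) linear0.
  have gE a (q : thread a) v : nat_at g (Pt q) v =
      nat_at (h a) (Pt q) (nat_at (p a) (Pt q) (nat_at l' (Pt q) v)).
    by rewrite gPt !nat_at_comp.
  exists g; split=> [a|u uh].
    apply: nat_ext => x v; have [ax|[q xq]] := off_threadP a x.
      by rewrite [v](supp_off _ (Ua a) ax) !linear0.
    subst x; rewrite nat_at_comp gE nat_at_comp -[nat_at l' _ _]nat_at_comp.
    by rewrite l'r' eE !pi.
  apply: nat_ext => -[v|a q] w.
    by rewrite -[w]r'K l'E eVtx zero_lfunE !linear0.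
  rewrite gE -[in RHS](r'K (Pt q) w) l'E eE -uh.
  by rewrite pi !nat_at_comp.
(* Along the thread of [a], [e] equals the idempotent of [U a]. Hence [MNF] is there a retract of
   the complement [N] of [U a], and [N] is reduced. *)
- apply: reduced_noise_free => a; have [_ _ _ [N [j [q [Nred jq]]]]] := ipP a.
  apply: (reduced_retract (u := comp C q l) (w := comp C r j)) Nred => b v.
  have e_bar m :
      nat_at (comp C (i a) (p a)) (bar_obj b) m = nat_at e (bar_obj b) m.
    case: b {v} m => [|t|] m /=; rewrite ?ePt // eVtx nat_at_comp zero_lfunE.
      by rewrite [nat_at (p a) _ m](supp_off _ (Ua a) _) ?linear0.
    by rewrite [nat_at (p a) _ m](supp_off _ (Ua a) _) ?linear0.
  rewrite !nat_at_comp -[nat_at j _ _]nat_at_comp.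
  have -> : comp C j q = idm C M - comp C (i a) (p a) by rewrite -jq addrK.
  rewrite nat_atD nat_atNeg add_lfunE opp_lfunE nat_at_id e_bar -l'r'.
  rewrite nat_at_comp -[nat_at r' _ _]nat_at_comp r'l nat_at0 zero_lfunE.
  by rewrite linear0 subr0 -nat_at_comp rl nat_at_id.
- exact: Ua.
- by move=> a; case: (ipP a).
Qed.

Lemma qnfP M : quasi_noise_free M <-> forall a, bounded M a.
Proof.
by split=> [Mqnf a|]; [apply: bounded_of_qnf|apply: qnf_of_bounded].
Qed.

Lemma qnf_sub M N (u : hom C M N) : (forall x, lker (nat_at u x) = 0%VS) ->
  quasi_noise_free N -> quasi_noise_free M.
Proof. by rewrite !qnfP => u_inj Nb a; apply: bounded_sub u_inj (Nb a). Qed.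

Lemma qnf_quot M N (u : hom C M N) : (forall x, limg (nat_at u x) = fullv) ->
  quasi_noise_free M -> quasi_noise_free N.
Proof. by rewrite !qnfP => u_onto Mb a; apply: bounded_quot u_onto (Mb a). Qed.

Lemma qnf_ext M N W (u : hom C M N) (w : hom C N W) :
  (forall x, lker (nat_at u x) = 0%VS) ->
  (forall x, limg (nat_at u x) = lker (nat_at w x)) ->
  quasi_noise_free M -> quasi_noise_free W -> quasi_noise_free N.
Proof.
by rewrite !qnfP => u_inj uw Mb Wb a; apply: bounded_ext u_inj uw (Mb a) (Wb a).
Qed.

Lemma qnf_zero M : is_zero C M -> quasi_noise_free M.
Proof.
move=> M0; have MM := direct_sum_zero M M0.
exists M, M, (fun _ => M); split=> //.
- exists (fun _ => 0) => X h; have [z _] := M0 X.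
  by exists 0; split=> [a|u _]; rewrite [RHS]z.
- move=> N NM _; apply/is_zeroP => x.
  case: NM => N' /(direct_sum_dim x); move/is_zeroP: M0 => ->.
  by move=> /esym/eqP; rewrite addn_eq0 => /andP [/eqP].
- by move=> a x []; move: x; apply/is_zeroP.
- by move=> a; apply: finite_sum_zero.
Qed.

(* Testing on the pointwise kernel is enough; it is quasi noise free when [M]
   is, which is what makes this usable inside the subcategory. *)
Lemma inj_of_mono M N (f : hom C M N) :
  (forall K (i : hom C K M), (forall x, lker (nat_at i x) = 0%VS) ->
    comp C f i = comp C f 0 -> i = 0) ->
  forall x, lker (nat_at f x) = 0%VS.
Proof.
move=> f_mono x; have [K [i iP]] := ex_subrep (@stable_ker _ _ _ _ f).
have [_ <-] := iP x; rewrite (f_mono K i); first exact: lim0g.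
  by move=> y; have [] := iP y.
by rewrite lc_comp0r; apply/comp0_at => y; have [_ ->] := iP y.
Qed.

Lemma onto_of_epi M N (f : hom C M N) :
  (forall K (q : hom C N K), (forall x, limg (nat_at q x) = fullv) ->
    comp C q f = comp C 0 f -> q = 0) ->
  forall x, limg (nat_at f x) = fullv.
Proof.
move=> f_epi x; have [K [q qP]] := ex_quotrep (@stable_img _ _ _ _ f).
have [_ <-] := qP x; rewrite (f_epi K q).
- by apply/vspaceP => v; rewrite memv_ker zero_lfunE eqxx memvf.
- by move=> y; have [] := qP y.
by rewrite lc_comp0l; apply/comp0_at => y; have [_ ->] := qP y.
Qed.

(** Uniqueness in the two universal properties makes [f] mono and [g] epi, hence pointwise injective
    and onto. In the middle, the pointwise kernel of [g] factors through [f]. *)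
Lemma short_exact_at M N W (f : hom C M N) (g : hom C N W) :
  short_exact f g ->
  [/\ forall x, lker (nat_at f x) = 0%VS,
      forall x, limg (nat_at g x) = fullv
    & forall x, limg (nat_at f x) = lker (nat_at g x)].
Proof.
case=> [[gf f_ker] [_ g_coker]]; split.
- apply: inj_of_mono => K i _ fi; have [|u [_ u_uniq]] := f_ker K 0.
    by rewrite lc_comp0r.
  by rewrite -(u_uniq i) ?(u_uniq 0) ?fi ?lc_comp0r.
- apply: onto_of_epi => K q _ qg; have [|u [_ u_uniq]] := g_coker K 0.
    by rewrite lc_comp0l.
  by rewrite -(u_uniq q) ?(u_uniq 0) ?qg ?lc_comp0l.
move=> x; apply/eqP; rewrite eqEsubv; apply/andP; split.
  by move/comp0_at: gf.
have [K [i iP]] := ex_subrep (@stable_ker _ _ _ _ g).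
have gi : comp C g i = 0 by apply/comp0_at => y; have [_ ->] := iP y.
have [u [fu _]] := f_ker K i gi; have [_ <-] := iP x.
rewrite -fu; apply/subvP => _ /memv_imgP [v _ ->].
by rewrite nat_at_comp memv_img ?memvf.
Qed.

Lemma qnf_serre : is_serre C (@quasi_noise_free k Q).
Proof.
split; first by exists (zero_rep k Q); apply/qnf_zero/zero_rep_zero.
move=> M N W f g /short_exact_at [f_inj g_onto fg].
split=> [Nq|[Mq Wq]]; last exact: qnf_ext f_inj fg Mq Wq.
by split; [apply: qnf_sub f_inj Nq|apply: qnf_quot g_onto Nq].
Qed.

(** The test objects of a full subcategory are among those of the ambient category. *)
Lemma is_kernel_full (M N K : {M : rep k Q | quasi_noise_free M})
    (f : hom C (sval M) (sval N)) (i : hom C (sval K) (sval M)) :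
  is_kernel f i -> @is_kernel _ _ (rep_qnf k Q) M N K f i.
Proof. by case=> fi uni; split=> // W; apply: uni. Qed.

Lemma is_cokernel_full (M N K : {M : rep k Q | quasi_noise_free M})
    (f : hom C (sval M) (sval N)) (q : hom C (sval N) (sval K)) :
  is_cokernel f q -> @is_cokernel _ _ (rep_qnf k Q) M N K f q.
Proof. by case=> qf uni; split=> // W; apply: uni. Qed.

Lemma ex_kernel M N (f : hom C M N) : exists K (i : hom C K M),
  [/\ is_kernel f i, forall x, lker (nat_at i x) = 0%VS
    & forall x, limg (nat_at i x) = lker (nat_at f x)].
Proof.
have [K [i iP]] := ex_subrep (@stable_ker _ _ _ _ f).
have i_inj x : lker (nat_at i x) = 0%VS by have [] := iP x.
exists K, i; split=> // [|x]; last by have [] := iP x.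
by apply: is_kernel_at => // x; have [] := iP x.
Qed.

Lemma ex_cokernel M N (f : hom C M N) : exists K (q : hom C N K),
  [/\ is_cokernel f q, forall x, limg (nat_at q x) = fullv
    & forall x, lker (nat_at q x) = limg (nat_at f x)].
Proof.
have [K [q qP]] := ex_quotrep (@stable_img _ _ _ _ f).
have q_onto x : limg (nat_at q x) = fullv by have [] := qP x.
exists K, q; split=> // [|x]; last by have [] := qP x.
by apply: is_cokernel_at => // x; have [] := qP x.
Qed.

(** The kernels, cokernels and biproducts of [rep_pwf] stay in the subcategory, by closure under
    subobjects, quotients and extensions. *)
Lemma qnf_abelian : is_abelian (rep_qnf k Q).
Proof.
split.
- have Z0 := @zero_rep_zero k Q.
  by exists (exist _ _ (qnf_zero Z0)) => -[M Mq]; apply: Z0.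
- move=> [M Mq] [N Nq]; have [i1 [i2 [p1 [p2 sum]]]] := direct_sum_rep M N.
  have Sq : quasi_noise_free (sum_rep M N).
    apply: (qnf_ext (u := i1) (w := p2)) => // x;
      by have [] := biproduct_at sum x.
  exists (exist _ _ Sq), i1, i2, p1, p2.
  by case: sum => *; split.
- move=> [M Mq] [N Nq] f; have [K [i [f_i i_inj _]]] := ex_kernel f.
  by exists (exist _ K (qnf_sub i_inj Mq)), i; apply: is_kernel_full.
- move=> [M Mq] [N Nq] f; have [K [q [f_q q_onto _]]] := ex_cokernel f.
  by exists (exist _ K (qnf_quot q_onto Nq)), q; apply: is_cokernel_full.
- move=> [M Mq] [N Nq] f f_mono.
  have f_inj := inj_of_mono (fun K i i_inj =>
    f_mono (exist _ K (qnf_sub i_inj Mq)) i 0).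
  have [K [q [_ q_onto fq]]] := ex_cokernel f.
  exists (exist _ K (qnf_quot q_onto Nq)), q; apply: is_kernel_full.
  by apply: is_kernel_at => // x; rewrite fq.
move=> [M Mq] [N Nq] f f_epi.
have f_onto := onto_of_epi (fun K q q_onto =>
  f_epi (exist _ K (qnf_quot q_onto Nq)) q 0).
have [K [i [_ i_inj fi]]] := ex_kernel f.
exists (exist _ K (qnf_sub i_inj Mq)), i; apply: is_cokernel_full.
exact: is_cokernel_at.
Qed.

End Criterion.

Theorem proposition7p1 (k : closedFieldType) (Q : thread_quiver) :
  is_serre (rep_pwf k Q) (@quasi_noise_free k Q) /\
  is_abelian (rep_qnf k Q).
Proof. by split; [apply: qnf_serre|apply: qnf_abelian]. Qed.
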